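(* Let $Y$ be an intensity-reweighted moment stationary (IRMS) spatio-temporal point process on $\mathbb{R}^d\times\mathbb{R}$ with known intensity function $\lambda$, observed within a compact region $W_S\times W_T\subseteq\mathbb{R}^d\times\mathbb{R}$. Let $r,t\ge 0$ be such that $J_{\rm inhom}(r,t)$ is defined (i.e. its defining series converges absolutely) and \[ \limsup_{n\to\infty}\left(\frac{\bar\lambda^n}{n!}\int_{S_r^t}\cdots\int_{S_r^t}\frac{\rho^{(n)}((x_1,t_1),\ldots,(x_n,t_n))}{\lambda(x_1,t_1)\cdots\lambda(x_n,t_n)}\prod_{i=1}^n dx_i\,dt_i\right)^{1/n}<1 . \] Assume that $\ell(W_S^{\ominus r}\times W_T^{\ominus t})>0$ and let $L\subseteq W_S\times W_T$ be a finite point grid with $L\cap(W_S^{\ominus r}\times W_T^{\ominus t})\ne\emptyset$. Then: (1) The estimator \[ \frac{1}{|L\cap(W_S^{\ominus r}\times W_T^{\ominus t})|}\sum_{l\in L\cap(W_S^{\ominus r}\times W_T^{\ominus t})}\ \prod_{(x,s)\in Y\cap(l+S_r^t)}\left(1-\frac{\bar\lambda}{\lambda(x,s)}\right) \] of $1-F_{\rm inhom}(r,t)$ is unbiased. (2) The estimator \[ \frac{1}{|Y\cap(W_S^{\ominus r}\times W_T^{\ominus t})|}\sum_{(x',s')\in Y\cap(W_S^{\ominus r}\times W_T^{\ominus t})}\ \prod_{(x,s)\in(Y\setminus\{(x',s')\})\cap((x',s')+S_r^t)}\left(1-\frac{\bar\lambda}{\lambda(x,s)}\right) \] of $1-G_{\rm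 inhom}(r,t)$ is ratio-unbiased, i.e. the expectation of the sum over $(x',s')$ divided by $\mathbb{E}\,|Y\cap(W_S^{\ominus r}\times W_T^{\ominus t})|$ equals $1-G_{\rm inhom}(r,t)$.
   Context: Let $d\ge1$; $\|\cdot\|$ is the Euclidean norm on $\mathbb{R}^d$, $\ell$ is Lebesgue measure on $\mathbb{R}^d\times\mathbb{R}$, $|\cdot|$ of a finite set is its cardinality, and $S_r^t=\{(x,s)\in\mathbb{R}^d\times\mathbb{R}:\|x\|\le r,\ |s|\le t\}$. $N$ is the space of locally finite counting measures on $\mathbb{R}^d\times\mathbb{R}$ with the $\sigma$-algebra generated by the maps $\varphi\mapsto\varphi(A)$, $A$ Borel. A spatio-temporal point process (STPP) $Y$ is a random element of $N$ that is almost surely simple; it is identified with its random set of points. Empty products equal $1$. Eroded domains: $W_S^{\ominus r}=\{x\in W_S: d_{\mathbb{R}^d}(x,\partial W_S)\ge r\}$ (equivalently, the closed Euclidean ball of radius $r$ about $x$ lies in $W_S$) and $W_T^{\ominus t}=\{s\in W_T: d_{\mathbb{R}}(s,\partial W_T)\ge t\}$, where $\partial$ denotes boundary. Product densities: $\rho^{(n)}$, $n\ge1$, are the permutation-invariant densities of the (locally finite) factorial moment measures of $Y$ with respect to the $n$-fold product of $\ell$: for all measurable $h\ge0$, $\mathbb{E}[\sum^{\neq}_{y_1,\ldots,y_n\in Y}h(y_1,\ldots,y_n)]=\int\cdots\int h\,\rho^{(n)}\,dy_1\cdots dy_n$, the sum being over $n$-tuples of pairwise distinct points of $Y$. The intensity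 function is $\lambda(x,t)=\rho^{(1)}(x,t)$, and $\bar\lambda=\inf_{(x,t)}\lambda(x,t)$. $n$-point correlation functions: $\xi_1\equiv1$ and, recursively in $n$, $\dfrac{\rho^{(n)}(y_1,\ldots,y_n)}{\prod_{k=1}^n\lambda(y_k)}=\sum_{k=1}^n\sum_{D_1,\ldots,D_k}\prod_{j=1}^k\xi_{|D_j|}(\{y_i:i\in D_j\})$, where the inner sum is over all partitions of $\{1,\ldots,n\}$ into $k$ non-empty sets $D_1,\ldots,D_k$. IRMS: $Y$ is intensity-reweighted moment stationary if product densities of all orders exist, $\bar\lambda>0$, and for every $n\ge1$, $\xi_n(y_1+c,\ldots,y_n+c)=\xi_n(y_1,\ldots,y_n)$ for almost all $y_1,\ldots,y_n\in\mathbb{R}^d\times\mathbb{R}$ and all $c\in\mathbb{R}^d\times\mathbb{R}$. Translation-invariant versions of $\xi_n$ are used when evaluating with one argument equal to the origin $(0,0)$. Inhomogeneous $J$-function: $J_n(r,t)=\int_{S_r^t}\cdots\int_{S_r^t}\xi_{n+1}((0,0),(x_1,t_1),\ldots,(x_n,t_n))\prod_{i=1}^n dx_i\,dt_i$ and $J_{\rm inhom}(r,t)=1+\sum_{n=1}^\infty\frac{(-\bar\lambda)^n}{n!}J_n(r,t)$, for all $r,t\ge0$ for which the series is absolutely convergent. Reduced Palm distributions $P^{!(x,t)}$ (with expectation $\mathbb{E}^{!(x,t)}$) are the probability measures on $N$, measurable in $(x,t)$, satisfying $\mathbb{E}[\sum_{(x,t)\in Y}g(x,t,Y\setminus\{(x,t)\})]=\int_{\mathbb{R}^d\times\mathbb{R}}\mathbb{E}^{!(x,t)}[g(x,t,Y)]\lambda(x,t)\,dx\,dt$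 for all measurable $g\ge0$. With $u_{r,t}^{(a,b)}(x,s)=\bar\lambda\,\mathbf 1\{\|a-x\|\le r,|b-s|\le t\}/\lambda(x,s)$, define $G_{\rm inhom}(r,t)=1-\mathbb{E}^{!(a,b)}[\prod_{(x,s)\in Y}(1-u_{r,t}^{(a,b)}(x,s))]$ and $F_{\rm inhom}(r,t)=1-\mathbb{E}[\prod_{(x,s)\in Y}(1-u_{r,t}^{(a,b)}(x,s))]$; under the stated hypotheses both are constant for $\ell$-almost every $(a,b)\in\mathbb{R}^d\times\mathbb{R}$, and $G_{\rm inhom}(r,t)$, $F_{\rm inhom}(r,t)$ denote these constant values. *)

(* Defs.v *)
From HB Require Import structures.
From mathcomp Require Import all_boot all_order all_algebra.
From mathcomp Require Import all_classical all_reals all_analysis.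
From mathcomp Require Import finmap measurable_realfun.

Set Implicit Arguments.
Unset Strict Implicit.
Unset Printing Implicit Defensive.

Import Order.TTheory GRing.Theory Num.Theory.
Import numFieldNormedType.Exports.

Local Open Scope classical_set_scope.
Local Open Scope ring_scope.

Section sprod.
Context d1 d2 (T1 : measurableType d1) (T2 : measurableType d2) (R : realType).
Variable m1 : {sigma_finite_measure set T1 -> \bar R}.
Variable m2 : {sigma_finite_measure set T2 -> \bar R}.

(* An alias of [m1 \x m2]: on [product_measure1] itself, the sigma-finite
   instance of the library is shadowed by the one for probabilities. *)
Definition sprod : set (T1 * T2) -> \bar R := (m1 \x m2)%E.

HB.instance Definition _ := Measure.on sprod.

Let sprod_sigma_finite : sigma_finite setT sprod.
Proof.
have /sigma_finiteP[F [TF ndF Foo]] := sigma_finiteT m1.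
have /sigma_finiteP[G [TG ndG Goo]] := sigma_finiteT m2.
exists (fun n => F n `*` G n).
  rewrite -setXTT TF TG predeqE => -[x y]; split.
    move=> [/= [k _ Fkx] [l _ Gly]]; exists (maxn k l) => //; split.
    - by move: x Fkx; exact/subsetPset/ndF/leq_maxl.
    - by move: y Gly; exact/subsetPset/ndG/leq_maxr.
  by move=> [k _ []/= ? ?]; split; exists k.
move=> k; have [? ?] := Foo k; have [? ?] := Goo k.
split; first exact: measurableX.
by rewrite /sprod product_measure1E// lte_mul_pinfty// ge0_fin_numE.
Qed.

HB.instance Definition _ := Measure_isSigmaFinite.Build _ _ _ sprod
  sprod_sigma_finite.

End sprod.

Section transport.
Context d1 d2 (T1 : measurableType d1) (T2 : measurableType d2) (R : realType).
Variable m : {sigma_finite_measure set T1 -> \bar R}.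
Variables (f : T1 -> T2) (g : T2 -> T1).
Hypotheses (mf : measurable_fun setT f) (mg : measurable_fun setT g).
Hypothesis fK : cancel f g.

(* The pushforward of [m] along [f]; the measurable left inverse [g] is what
   makes it sigma-finite. *)
Definition transport of measurable_fun setT f & measurable_fun setT g
  & cancel f g : set T2 -> \bar R := pushforward m f.
Local Notation tm := (transport mf mg fK).

Let preimage_meas A : measurable A -> measurable (f @^-1` A).
Proof. by move=> mA; rewrite -[X in measurable X]setTI; exact: mf. Qed.

Let transport0 : tm set0 = 0%E.
Proof. by rewrite /transport /pushforward preimage_set0 measure0. Qed.

Let transport_ge0 A : (0 <= tm A)%E.
Proof. exact: measure_ge0. Qed.

Let transport_sigma_additive : semi_sigma_additive tm.
Proof.
move=> F mF tF mUF; rewrite /transport /pushforward preimage_bigcup.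
apply: measure_semi_sigma_additive.
- by move=> k; exact: preimage_meas.
- apply/trivIsetP => /= i j _ _ ij; rewrite -preimage_setI.
  by move/trivIsetP : tF => /(_ _ _ _ _ ij) ->//; rewrite preimage_set0.
- by rewrite -preimage_bigcup; exact: preimage_meas.
Qed.

HB.instance Definition _ := isMeasure.Build _ _ _ tm
  transport0 transport_ge0 transport_sigma_additive.

Let transport_sigma_finite : sigma_finite setT tm.
Proof.
have [F TF Foo] := sigma_finiteT m.
exists (fun i => g @^-1` F i).
  by rewrite -preimage_bigcup -TF preimage_setT.
move=> i; have [mF Fi] := Foo i; split.
  by rewrite -[X in measurable X]setTI; exact: mg.
rewrite /transport /pushforward -comp_preimage.
by rewrite (_ : g \o f = id)//; apply/funext => p; exact: fK.
Qed.

HB.instance Definition _ := Measure_isSigmaFinite.Build _ _ _ tm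
  transport_sigma_finite.

End transport.

Section nil_measure.
Context d (T : measurableType d) (R : realType).

Definition nil_measure : set (0.-tuple T) -> \bar R := dirac [tuple].

HB.instance Definition _ := Probability.on nil_measure.

End nil_measure.

Section cons_pair.
Context d (T : measurableType d) (n : nat).

Definition cons_pair (p : T * n.-tuple T) : n.+1.-tuple T :=
  [tuple of p.1 :: p.2].

Definition uncons_pair (t : n.+1.-tuple T) : T * n.-tuple T :=
  (thead t, [tuple of behead t]).

Lemma cons_pairK : cancel cons_pair uncons_pair.
Proof. by move=> [x t]; congr pair => //; exact: val_inj. Qed.

Lemma measurable_cons_pair : measurable_fun setT cons_pair.
Proof. exact: measurable_cons. Qed.

Lemma measurable_uncons_pair : measurable_fun setT uncons_pair.
Proof.
by apply: measurable_fun_pair; [exact: measurable_tnth|exact: measurable_behead].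
Qed.

End cons_pair.

Fixpoint tuple_measure d (T : measurableType d) (R : realType)
    (mu : {sigma_finite_measure set T -> \bar R}) (n : nat) :
    {sigma_finite_measure set (n.-tuple T) -> \bar R} :=
  match n with
  | 0%N => @nil_measure d T R
  | m.+1 => transport (sprod mu (tuple_measure mu m))
      (@measurable_cons_pair _ T m) (@measurable_uncons_pair _ T m)
      (@cons_pairK _ T m)
  end.

Definition measure_rV_display : measure_display.
Proof. by constructor. Qed.

Section measurable_rV.
Context (R : realType) (n : nat).

Let coor (i : 'I_n) (x : 'rV[R]_n) : measurableTypeR R := x ord0 i.

Let rV_set0 : g_sigma_preimage coor set0.
Proof. exact: sigma_algebra0. Qed.

Let rV_setC A : g_sigma_preimage coor A -> g_sigma_preimage coor (~` A).
Proof. exact: sigma_algebraC. Qed.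

Let rV_bigcup (F : _^nat) : (forall i, g_sigma_preimage coor (F i)) ->
  g_sigma_preimage coor (\bigcup_i (F i)).
Proof. exact: sigma_algebra_bigcup. Qed.

(* The sigma-algebra on R^n generated by the coordinates, i.e. the Borel
   sigma-algebra. *)
HB.instance Definition _ := @isMeasurable.Build measure_rV_display 'rV[R]_n
  (g_sigma_preimage coor) rV_set0 rV_setC rV_bigcup.

Lemma measurable_coor (i : 'I_n) :
  measurable_fun setT (fun x : 'rV[R]_n => x ord0 i : measurableTypeR R).
Proof.
move=> _ Y mY; rewrite setTI; apply: sub_sigma_algebra => /=.
rewrite -bigcup_seq/=; exists i => /=; first by rewrite mem_index_enum.
by exists Y => //; rewrite setTI.
Qed.

Lemma measurable_fun_rV d (T : measurableType d) (f : T -> 'rV[R]_n) :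
  (forall i, measurable_fun setT (fun x => f x ord0 i : measurableTypeR R)) ->
  measurable_fun setT f.
Proof.
move=> mf; apply: (measurability (\big[setU/set0]_(i < n)
  preimage_set_system setT (coor i) measurable)) => //.
move=> _ [B + <-]; rewrite -bigcup_seq => -[i _ [A mA <-]].
by rewrite setTI; exact: (mf i measurableT A mA).
Qed.

Lemma measurable_rV_set1 (x : 'rV[R]_n) : measurable [set x].
Proof.
rewrite (_ : [set x] = \big[setI/setT]_(i < n) ((coor i) @^-1` [set x ord0 i])).
  apply: bigsetI_measurable => i _; rewrite -[X in measurable X]setTI.
  by apply: measurable_coor => //; exact: measurable_set1.
apply/seteqP; split => [y -> |y yx]; first by rewrite -bigcap_seq => i _.
apply/rowP => i; move: yx; rewrite -bigcap_seq => /(_ i); apply.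
by rewrite /= mem_index_enum.
Qed.

Definition rV_of_tuple (t : n.-tuple (measurableTypeR R)) : 'rV[R]_n :=
  \row_i tnth t i.

Definition tuple_of_rV (x : 'rV[R]_n) : n.-tuple (measurableTypeR R) :=
  [tuple (x ord0 i : measurableTypeR R) | i < n].

Lemma rV_of_tupleK : cancel rV_of_tuple tuple_of_rV.
Proof. by move=> t; apply: eq_from_tnth => i; rewrite tnth_mktuple mxE. Qed.

Lemma measurable_rV_of_tuple : measurable_fun setT rV_of_tuple.
Proof.
apply: measurable_fun_rV => i.
rewrite (_ : (fun _ => _) = (@tnth n (measurableTypeR R))^~ i).
  exact: measurable_tnth.
by apply/funext => t; rewrite mxE.
Qed.

Lemma measurable_tuple_of_rV : measurable_fun setT tuple_of_rV.
Proof.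
apply/measurable_fun_tnthP => i.
rewrite (_ : _ \o _ = coor i); first exact: measurable_coor.
by apply/funext => x /=; rewrite tnth_mktuple.
Qed.

Definition lebesgue_rV : {sigma_finite_measure set 'rV[R]_n -> \bar R} :=
  transport (tuple_measure (@lebesgue_measure R) n)
    measurable_rV_of_tuple measurable_tuple_of_rV rV_of_tupleK.

End measurable_rV.

Notation spacetime R d := ('rV[R]_d * measurableTypeR R)%type.

Section spacetime.
Context (R : realType) (d : nat).
Local Notation T := (spacetime R d).

Definition ell : {sigma_finite_measure set T -> \bar R} :=
  sprod (lebesgue_rV R d) (@lebesgue_measure R).

Lemma measurable_spacetime_set1 (y : T) : measurable [set y].
Proof.
rewrite (_ : [set y] = [set y.1] `*` [set y.2]); last first.
  by apply/seteqP; split => [_ -> //|[a b] [/= -> ->]]; rewrite -surjective_pairing.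
by apply: measurableX; [exact: measurable_rV_set1|exact: measurable_set1].
Qed.

(* The Euclidean norm; the library's norm on ['rV[R]_d] is the sup norm. *)
Definition enorm (x : 'rV[R]_d) : R := Num.sqrt (\sum_(i < d) x ord0 i ^+ 2).

(* S_r^t *)
Definition cyl (r t : R) : set T := [set z | enorm z.1 <= r /\ `|z.2| <= t].

Definition st_bounded (A : set T) := exists k : R, A `<=` cyl k k.

Definition boundary (X : topologicalType) (A : set X) : set X :=
  closure A `\` A°.

(* The Euclidean distance to the boundary is an infimum, +oo when the boundary is
   empty. *)
Definition erode_S (W : set 'rV[R]_d) (r : R) : set 'rV[R]_d :=
  [set x | W x /\
    (r%:E <= ereal_inf [set (enorm (x - z))%:E | z in boundary W])%E].

Definition erode_T (W : set R) (t : R) : set R :=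
  [set s | W s /\
    (t%:E <= ereal_inf [set `|s - z|%:E | z in boundary W])%E].

End spacetime.
Arguments ell {R d}.

Section configurations.
Context (R : realType) (d : nat).
Local Notation T := (spacetime R d).

Definition locally_finite_counting (phi : set T -> \bar R) :=
  forall A, measurable A -> st_bounded A -> exists k : nat, phi A = k%:R%:E.

Record lfcm := LFCM {
  lfcm_measure :> {measure set T -> \bar R} ;
  lfcmP : locally_finite_counting lfcm_measure }.

HB.instance Definition _ := gen_eqMixin lfcm.
HB.instance Definition _ := gen_choiceMixin lfcm.

Lemma mzero_lfcm : locally_finite_counting (@mzero _ T R).
Proof. by move=> A _ _; exists 0%N. Qed.

HB.instance Definition _ := isPointed.Build lfcm (LFCM mzero_lfcm).

Definition lfcm_evaluations : set (set lfcm) :=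
  \bigcup_(A in @measurable _ T)
    preimage_set_system setT (fun phi : lfcm => phi A) measurable.

(* N with the sigma-algebra generated by the maps [phi |-> phi A]. *)
Definition config := g_sigma_algebraType lfcm_evaluations.

(* The atoms of [phi]; a simple [phi] is identified with this set. *)
Definition points (phi : config) : set T :=
  [set y | (0 < (phi : lfcm) [set y])%E].

Definition simple (phi : config) :=
  forall y, ((phi : lfcm) [set y] <= 1)%E.

Lemma measurable_setC1 (y : T) : measurable (~` [set y]).
Proof. by apply: measurableC; exact: measurable_spacetime_set1. Qed.

Lemma remove_lfcm (phi : config) (y : T) :
  locally_finite_counting (mrestr (phi : lfcm) (measurable_setC1 y)).
Proof.
move=> A mA [k Ak]; apply: lfcmP; first exact: measurableI (measurable_setC1 y).
by exists k => z [/Ak].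
Qed.

(* [phi] restricted to the complement of [{y}], i.e. [phi] minus the Dirac mass
   at [y] when [phi] is simple and [y] is one of its points. *)
Definition remove (phi : config) (y : T) : config := LFCM (remove_lfcm phi y).

Definition distinct_tuples (phi : config) (n : nat) : set (n.-tuple T) :=
  [set y : n.-tuple T | uniq y /\ forall i, points phi (tnth y i)].

End configurations.
Arguments distinct_tuples {R d} phi n _.

Section process.
Context (R : realType) (d : nat).
Local Notation T := (spacetime R d).
Context (dO : measure_display) (Omega : measurableType dO).
Variables (P : probability Omega R) (Y : Omega -> config R d).

Definition stpp :=
  measurable_fun setT Y /\ {ae P, forall w, simple (Y w)}.

Definition product_density (n : nat) (rho : n.-tuple T -> R) :=
  [/\ forall y, 0 <= rho y,
      measurable_fun setT rho,
      forall y z : n.-tuple T, perm_eq y z -> rho y = rho z,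
      forall B : set T, measurable B -> st_bounded B ->
        (\int[P]_w (\esum_(y in distinct_tuples (Y w) n)
          (\1_[set z : n.-tuple T | forall i, B (tnth z i)] y)%:E) < +oo)%E &
      forall h : n.-tuple T -> \bar R, measurable_fun setT h ->
        (forall y, (0 <= h y)%E) ->
        (\int[P]_w (\esum_(y in distinct_tuples (Y w) n) h y) =
         \int[tuple_measure ell n]_y (h y * (rho y)%:E))%E].

(* The reduced Palm distributions [P^{!(x,t)} = Q (x,t)], with respect to the
   intensity function [lam]. *)
Definition reduced_palm (lam : T -> R) (Q : R.-pker T ~> config R d) :=
  forall g : T * config R d -> \bar R, measurable_fun setT g ->
    (forall z, (0 <= g z)%E) ->
    (\int[P]_w (\esum_(y in points (Y w)) g (y, remove (Y w) y)) =
     \int[ell]_y ((\int[Q y]_phi g (y, phi)) * (lam y)%:E))%E.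

End process.

Section correlation.
Context (R : realType) (d : nat).
Local Notation T := (spacetime R d).
(* [rho n] is the n-th product density and [xi n] the n-point correlation
   function, for n >= 1; the values at n = 0 play no role. *)
Implicit Types rho xi : forall n, n.-tuple T -> R.

Definition lambda rho (y : T) : R := rho 1%N [tuple y].

Definition lambda_bar rho : R := inf (range (lambda rho)).

Definition reweighted rho n (y : n.-tuple T) : R :=
  rho n y / \prod_(i < n) lambda rho (tnth y i).

Definition subtuple n (y : n.-tuple T) (D : {set 'I_n}) : #|D|.-tuple T :=
  [tuple tnth y (enum_val i) | i < #|D|].

Definition correlation_functions rho xi :=
  (forall y, xi 1%N y = 1) /\
  (forall n, (0 < n)%N -> forall y : n.-tuple T,
    reweighted rho y =
    \sum_(E : {set {set 'I_n}} | finset.partition E (finset.setTfor 'I_n))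
      \prod_(D in E) xi #|D| (subtuple y D)).

Definition translate n (c : T) (y : n.-tuple T) : n.-tuple T :=
  [tuple tnth y i + c | i < n].

Definition irms (dO : measure_display) (Omega : measurableType dO)
    (P : probability Omega R) (Y : Omega -> config R d) rho xi :=
  [/\ forall n, (0 < n)%N -> product_density P Y (@rho n),
      0 < lambda_bar rho,
      correlation_functions rho xi &
      forall n, (0 < n)%N -> forall c : T,
        {ae tuple_measure ell n, forall y, xi n (translate c y) = xi n y}].

Definition translation_invariant_versions xi xit :=
  forall n, (0 < n)%N ->
    [/\ measurable_fun setT (xit n),
        {ae tuple_measure ell n, forall y, xit n y = xi n y} &
        forall (c : T) y, xit n (translate c y) = xit n y].

Definition cylpow n (r t : R) : set (n.-tuple T) :=
  [set y : n.-tuple T | forall i, cyl r t (tnth y i)].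
Arguments cylpow : clear implicits.

(* The integral is -oo or +oo, hence [J_inhom_defined] fails, when the integrand
   is not integrable. Here and below, [xit] stands for translation-invariant versions of the
   correlation functions. *)
Definition J_n xit (r t : R) n : \bar R :=
  (\int[tuple_measure ell n]_(y in cylpow n r t)
     (xit n.+1 [tuple of (0 : T) :: y])%:E)%E.

Definition J_inhom_defined rho xit (r t : R) :=
  (\sum_(1 <= n <oo)
     `| ((- lambda_bar rho) ^+ n / n`!%:R)%:E * J_n xit r t n | < +oo)%E.

Definition moment_growth rho (r t : R) n : \bar R :=
  ((((lambda_bar rho) ^+ n / n`!%:R)%:E *
    \int[tuple_measure ell n]_(y in cylpow n r t) (reweighted rho y)%:E)
   `^ (n%:R^-1))%E.

End correlation.
Arguments cylpow {R d} n r t _.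

Section summary_functions.
Context (R : realType) (d : nat).
Local Notation T := (spacetime R d).
Variables (lam : T -> R) (lbar : R).

Definition u_weight (r t : R) (a y : T) : R :=
  lbar * ((enorm (a.1 - y.1) <= r) && (`|a.2 - y.2| <= t))%:R / lam y.

(* The possibly infinite set [points phi] has finitely many factors that differ
   from 1, for [u = u_weight r t a]. *)
Definition generating_product (u : T -> R) (phi : config R d) : R :=
  \big[*%R/1]_(y \in points phi) (1 - u y).

(* The constant [c] with [f = c] almost everywhere; unique when it exists, 0 by
   convention otherwise. *)
Definition ae_value (f : T -> \bar R) : R :=
  xget 0 [set c : R | {ae ell, forall a, f a = c%:E}].

Definition F_inhom (dO : measure_display) (Omega : measurableType dO)
    (P : probability Omega R) (Y : Omega -> config R d) (r t : R) : R :=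
  ae_value (fun a =>
    1 - 'E_P[fun w => generating_product (u_weight r t a) (Y w)])%E.

Definition G_inhom (Q : R.-pker T ~> config R d) (r t : R) : R :=
  ae_value (fun a =>
    1 - \int[Q a]_phi (generating_product (u_weight r t a) phi)%:E)%E.

(* l + S_r^t *)
Definition cyl_at (l : T) (r t : R) : set T := [set l + z | z in cyl r t].

Definition window_product (phi : config R d) (A : set T) : R :=
  \big[*%R/1]_(y \in points phi `&` A) (1 - lbar / lam y).

Definition card_set (A : set T) : nat := #|` fset_set A|.

Definition F_estimator (W L : set T) (r t : R) (phi : config R d) : R :=
  (card_set (L `&` W))%:R^-1 *
  \sum_(l \in L `&` W) window_product phi (cyl_at l r t).

Definition G_numerator (W : set T) (r t : R) (phi : config R d) : R :=
  \sum_(y \in points phi `&` W) window_product (remove phi y) (cyl_at y r t).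

Definition G_denominator (W : set T) (phi : config R d) : R :=
  (card_set (points phi `&` W))%:R.

End summary_functions.

Section estimation.
Context (R : realType) (dO : measure_display) (Omega : measurableType dO).
Variable P : probability Omega R.

Definition unbiased (est : Omega -> R) (theta : R) := 'E_P[est]%E = theta%:E.

(* The estimator is [num / den]. *)
Definition ratio_unbiased (num den : Omega -> R) (theta : R) :=
  ('E_P[num] / 'E_P[den] = theta%:E)%E.

End estimation.

(* Main.v *)
Require Import Defs.
From HB Require Import structures.
From mathcomp Require Import all_boot all_order all_algebra.
From mathcomp Require Import all_classical all_reals all_analysis.
From mathcomp Require Import finmap measurable_realfun.
From mathcomp Require Import ring zify.
Set Implicit Arguments.
Unset Strict Implicit.
Unset Printing Implicit Defensive.
Import Order.TTheory GRing.Theory Num.Theory.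
Import numFieldNormedType.Exports.
Local Open Scope classical_set_scope.
Local Open Scope ring_scope.

(** The weight [u a = u_weight r t a] vanishes outside [a + S], so only finitely many
    points matter and the window product at [a] is the product of the [1 - u a y] over
    the points [y]. Expanded, it is the alternating sum of the [E_n(a) / n!], where
    [E_n(a)] is the sum of the products of the weights over the ordered [n]-tuples of
    distinct points ([generating_product_expansion]). When the expectations of the
    [E_n(a) / n!] are summable, dominated convergence shows that they determine the
    expected product ([integral_alternating]). It remains to see, under the law of the
    process and under its reduced Palm distributions, that the moments of [E_n(a)] do
    not depend on [a] and that they are summable.

    Under the process, the moment of [E_n(a)] is [lambda_bar ^ n] times the integral of
    the reweighted density [rho_n / (lambda ... lambda)] over the [n]-th power of
    [a + S]. By definition of the correlation functions this density is a sum over set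
    partitions. With the translation-invariant versions of the correlation functions, the
    sum ([cluster_sum]) is exactly invariant and still equals the reweighted density
    almost everywhere ([ae_reweighted]), hence the integral is the same at every [a]
    ([expected_factorial_sum]); the root test gives summability. So the expected window
    product is the same constant at every [a], not only at almost every one. It is one
    minus the F-function, and the first claim follows by averaging over the grid.

    Under the Palm distribution at [a], the moment of [E_n(a)] is obtained from the
    density of order [n+1] with one argument at [a]; for almost every [a] it is
    [lambda_bar ^ n] times the integral of [cluster_sum] over the [n]-th power of [S]
    with one argument at the origin ([palm_factorial_sum_ae]). Splitting off the
    block of the origin in each set partition writes this integral as a binomial
    convolution of the [J_n] with the moments of the process ([cyl_moment_cluster]). The
    series of Palm moments is therefore dominated by the Cauchy product of two convergent
    series, the one that defines the J-function and the one controlled by the growth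
    condition ([palm_series_lty]). So the Palm expectation of the window product is
    almost everywhere one minus the G-function. The reduced Palm formula then gives the
    expected numerator of the second estimator as this constant times the integral of the
    intensity over the eroded window, and that integral, positive and finite, is the
    expected denominator.

    Measurability rests on the fact that a locally finite counting measure is purely
    atomic ([atom_exists]): sums over the points of a configuration become integrals
    against it ([measurable_esum_points]). *)

(** * The geometry of space-time *)

Section spacetime_geometry.
Context (R : realType) (d : nat).
Local Notation T := (spacetime R d).

Lemma measurable_enorm : measurable_fun setT (fun x : 'rV[R]_d => enorm x : measurableTypeR R).
Proof.
apply: (@measurableT_comp _ _ _ _ _ _ (@Num.sqrt R : _ -> measurableTypeR R)).
  exact: (continuous_measurable_fun (@sqrt_continuous R)).
apply: measurable_sum => i.
by apply: measurable_funX; exact: measurable_coor.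
Qed.

Lemma measurable_cyl (r t : R) : measurable (@cyl R d r t).
Proof.
rewrite (_ : cyl r t = [set x | enorm x <= r] `*` [set s : measurableTypeR R| `|s| <= t]).
  apply: measurableX.
    rewrite -[X in measurable X]setTI.
    rewrite (_ : [set x | enorm x <= r] = (@enorm R d) @^-1` `]-oo, r]).
      by apply: measurable_enorm.
    by apply/seteqP; split => x /=; rewrite in_itv.
  rewrite -[X in measurable X]setTI.
  rewrite (_ : [set x | _ <= t] = (fun s : measurableTypeR R => `|s|) @^-1` `]-oo, t]).
    by apply: (measurableT_comp (@normr_measurable R setT)) => //; exact: measurable_id.
  by apply/seteqP; split => x /=; rewrite in_itv.
by apply/seteqP; split => -[].
Qed.

Definition nat_cyl (n : nat) : set T := cyl n%:R n%:R.

Lemma bigcup_nat_cyl : \bigcup_n nat_cyl n = setT.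
Proof.
apply/seteqP; split => // -[x s] _.
have m0 : 0 <= Num.max (enorm x) `|s| by rewrite le_max normr_ge0 orbT.
exists (Num.bound (Num.max (enorm x) `|s|)) => //; split => /=;
  by rewrite (le_trans _ (ltW (archi_boundP m0)))// le_max lexx ?orbT.
Qed.

Lemma nd_nat_cyl : nondecreasing_seq nat_cyl.
Proof.
move=> m n mn; apply/subsetPset => -[x s] [/= h1 h2].
by split => /=; [apply: le_trans h1 _|apply: le_trans h2 _]; rewrite ler_nat.
Qed.

Lemma measurable_nat_cyl n : measurable (nat_cyl n).
Proof. exact: measurable_cyl. Qed.

Lemma st_bounded_nat_cyl n : st_bounded (nat_cyl n).
Proof. by exists n%:R. Qed.

Lemma coord_le_enorm (x : 'rV[R]_d) i : (`|x ord0 i| <= enorm x)%R.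
Proof.
rewrite -sqrtr_sqr; apply: ler_wsqrtr; rewrite (bigD1 i)//= lerDl sumr_ge0// => j _.
exact: sqr_ge0.
Qed.

(** Bounding the coordinates one by one takes the place of the triangle inequality
    for the Euclidean norm. *)
Lemma st_bounded_coord (A : set T) (M : R) :
  (forall y, A y -> (forall i, `|y.1 ord0 i| <= M)%R /\ (`|y.2| <= M)%R) -> st_bounded A.
Proof.
move=> AM; exists (Num.max (Num.sqrt (\sum_(i < d) M ^+ 2)) M) => y /AM[y1 y2].
split; rewrite le_max; apply/orP; [left|right] => //.
apply: ler_wsqrtr; apply: ler_sum => i _.
by rewrite -real_normK ?num_real// ler_sqr ?nnegrE// (le_trans _ (y1 i)).
Qed.

Lemma st_bounded_shift (r t : R) (a : T) : st_bounded [set y : T | cyl r t (y - a)%R].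
Proof.
apply: (@st_bounded_coord _ (Num.max (r + enorm a.1) (t + `|a.2|))%R) => y [/= h1 h2].
split=> [i|]; rewrite le_max; apply/orP; [left|right].
  rewrite -(subrK (a.1 ord0 i) (y.1 ord0 i)) (le_trans (ler_normD _ _))// lerD ?coord_le_enorm//.
  by apply: le_trans h1; have := coord_le_enorm (y.1 - a.1)%R i; rewrite !mxE.
by rewrite -(subrK a.2 y.2) (le_trans (ler_normD _ _))// lerD.
Qed.

Lemma cyl_atP (r t : R) (l y : T) : cyl_at l r t y <-> cyl r t (y - l)%R.
Proof.
split=> [[z cz <-]|cy]; first by rewrite addrC addKr.
by exists (y - l)%R => //; rewrite addrC subrK.
Qed.

Lemma measurable_spacetime_sub : measurable_fun setT (fun p : T * T => (p.2 - p.1)%R).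
Proof.
rewrite (_ : (fun p => _) = fun p : T * T => ((p.2.1 - p.1.1)%R, (p.2.2 - p.1.2)%R)); last first.
  by apply/funext => -[[a a'] [b b']].
have m1 := @measurable_fst _ _ T T; have m2 := @measurable_snd _ _ T T.
apply: measurable_fun_pair.
  apply: measurable_fun_rV => i.
  rewrite (_ : (fun x => _) = fun p : T * T => (p.2.1 ord0 i - p.1.1 ord0 i)%R); last first.
    by apply/funext => x; rewrite !mxE.
  apply: measurable_funB.
    apply: (measurableT_comp (measurable_coor i)).
    exact: (measurableT_comp (@measurable_fst _ _ _ _) m2).
  apply: (measurableT_comp (measurable_coor i)).
  exact: (measurableT_comp (@measurable_fst _ _ _ _) m1).
apply: measurable_funB.
  exact: (measurableT_comp (@measurable_snd _ _ _ _) m2).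
exact: (measurableT_comp (@measurable_snd _ _ _ _) m1).
Qed.

End spacetime_geometry.

Section borel_rV.
Context (R : realType) (d : nat).
Local Notation T := (spacetime R d).

(** The coordinates generate the Borel sets: an open set is the countable union of
    the boxes with rational centre and radius [1/(n+1)] that it contains. *)
Lemma measurable_open_rV (U : set 'rV[R]_d) : open U -> measurable U.
Proof.
move=> oU.
(* [p.2.+1] keeps the radius positive. *)
pose box (p : 'rV[rat]_d * nat) : set 'rV[R]_d :=
  [set x | forall i, `|x ord0 i - ratr (p.1 ord0 i)| < p.2.+1%:R^-1].
have mbox p : measurable (box p).
  rewrite (_ : box p = \bigcap_(i in [set: 'I_d])
      (fun x : 'rV[R]_d => x ord0 i : measurableTypeR R) @^-1` (ball (ratr (p.1 ord0 i) : R)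
        p.2.+1%:R^-1)).
    apply: fin_bigcap_measurable => // i _; rewrite -[X in measurable X]setTI.
    by apply: measurable_coor => //; exact: measurable_ball.
  by apply/seteqP; split => x /= h i; [move=> _|have := h i Logic.I]; rewrite /ball/= distrC.
rewrite (_ : U = \bigcup_(p in [set p | box p `<=` U]) box p).
  rewrite bigcup_mkcond; apply: countable_bigcupT_measurable => //.
  by move=> p; case: ifP => _.
apply/seteqP; split => [x Ux|x [p /= pU xp]]; last exact: pU.
have /nbhs_ballP[e /= e0 eU] : nbhs x U by exact: open_nbhs_nbhs.
have [n ne] : exists n : nat, n.+1%:R^-1 < e / 2.
  have e2 : 0 < e / 2 by rewrite divr_gt0.
  exists (Num.bound (e / 2)^-1); rewrite invf_plt ?posrE//.
  rewrite (lt_trans (archi_boundP _))// ?ltr_nat// invr_ge0; exact: ltW.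
have n0 : 0 < n.+1%:R^-1 :> R by rewrite invr_gt0.
have qx i : {q : rat | `|x ord0 i - ratr q| < n.+1%:R^-1}.
  apply: cid; have /rat_in_itvoo[q] : x ord0 i - n.+1%:R^-1 < x ord0 i + n.+1%:R^-1.
    by rewrite ltrD2l gtrN.
  by rewrite in_itv/= => h; exists q; rewrite distrC ltr_distl.
exists (\row_i sval (qx i), n) => [y yb|i].
  apply: eU; split => // i j; rewrite (ord1 i) /ball /=.
  have := yb j; have := svalP (qx j); rewrite /= mxE; move: (sval _) => q h1 h2.
  rewrite (splitr e) -(subrKA (ratr q) (x ord0 j)) (le_lt_trans (ler_normD _ _))//.
  by rewrite ltrD// ?(lt_trans _ ne)// distrC.
by rewrite /= mxE; exact: svalP (qx i).
Qed.

Lemma measurable_closed_rV (A : set 'rV[R]_d) : closed A -> measurable A.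
Proof.
by move=> cA; rewrite -(setCK A); apply: measurableC; apply: measurable_open_rV;
  exact: closed_openC.
Qed.

Lemma continuous_enorm (z : 'rV[R]_d) : continuous (fun x : 'rV[R]_d => enorm (x - z)).
Proof.
rewrite (_ : (fun x => _) = @Num.sqrt R \o (fun x : 'rV[R]_d =>
  \sum_(i < d) (x ord0 i - z ord0 i) ^+ 2)); last first.
  by apply/funext => x /=; congr Num.sqrt; apply: eq_bigr => i _; rewrite !mxE.
move=> x; apply: continuous_comp; last exact: sqrt_continuous.
apply: (@continuous_big R _ +%R 0 xpredT (@add_continuous R) _ _
  (fun (i : 'I_d) (x : 'rV[R]_d) => (x ord0 i - z ord0 i) ^+ 2)) => i _ {}x.
apply: (@continuous_comp _ _ _ (fun x : 'rV[R]_d => x ord0 i - z ord0 i) (fun y : R => y ^+ 2)).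
  have c : (fun x : 'rV[R]_d => x ord0 i) x @[x --> x] --> x ord0 i :=
    @coord_continuous R 1 d ord0 i x.
  by apply: (cvgB c); exact: cvg_cst.
exact: exprn_continuous.
Qed.

Lemma closed_erode_S (A : set 'rV[R]_d) (r : R) : closed A -> closed (erode_S A r).
Proof.
move=> cA.
rewrite (_ : erode_S A r = A `&` \bigcap_(z in boundary A) [set x | r <= enorm (x - z)]).
  apply: closedI => //; apply: closed_bigI => z _.
  apply: (@preimage_closed _ _ (fun x : 'rV[R]_d => enorm (x - z)) [set y | r <= y]).
    by move=> x _; exact: continuous_enorm.
  exact: closed_ge.
apply/seteqP; split => x [Ax h]; split => //.
  move=> z Az /=; rewrite -lee_fin; apply: le_trans h _.
  by apply: ereal_inf_lbound; exists z.
by apply: le_ereal_inf_tmp => _ [z Az <-]; rewrite lee_fin; exact: h.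
Qed.

Lemma closed_erode_T (A : set R) (t : R) : closed A -> closed (erode_T A t).
Proof.
move=> cA.
rewrite (_ : erode_T A t = A `&` \bigcap_(z in boundary A) [set x | t <= `|x - z|]).
  apply: closedI => //; apply: closed_bigI => z _.
  apply: (@preimage_closed _ _ (fun x : R => `|x - z|) [set y | t <= y]).
    move=> x _; apply: (@continuous_comp _ _ _ (fun x : R => x - z) (fun y : R => `|y|));
      last exact: norm_continuous.
    by apply: cvgB; [exact: cvg_id|exact: cvg_cst].
  exact: closed_ge.
apply/seteqP; split => x [Ax h]; split => //.
  move=> z Az /=; rewrite -lee_fin; apply: le_trans h _.
  by apply: ereal_inf_lbound; exists z.
by apply: le_ereal_inf_tmp => _ [z Az <-]; rewrite lee_fin; exact: h.
Qed.

Lemma compact_coord_bounded (A : set 'rV[R]_d) : compact A ->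
  exists M : R, forall x, A x -> forall i, `|x ord0 i| <= M.
Proof.
move=> cA.
have hM i : {M : R | forall x, A x -> `|x ord0 i| <= M}.
  apply: cid.
  have : compact ((fun x : 'rV[R]_d => x ord0 i) @` A).
    apply: continuous_compact => //; apply: continuous_subspaceT => x; exact: coord_continuous.
  move=> /compact_bounded[M [_ hM]]; exists (M + 1) => x Ax.
  by apply: (hM (M + 1)) => //; [rewrite ltrDl|exists x].
exists (\sum_i `|sval (hM i)|) => x Ax i.
apply: le_trans (svalP (hM i) x Ax) _; apply: le_trans (ler_norm _) _.
by rewrite (bigD1 i)//= lerDl sumr_ge0.
Qed.

(** The erosions of a closed set are closed, being cut out by the closed conditions
    [r <= enorm (x - z)] for [z] on the boundary; so compactness of the window makes
    the eroded window a bounded Borel set. *)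
Lemma eroded_window (WS : set 'rV[R]_d) (WT : set R) (r t : R) :
  compact (WS `*` WT) -> (erode_S WS r `*` erode_T WT t) !=set0 ->
  measurable (erode_S WS r `*` erode_T WT t : set T) /\
  st_bounded (erode_S WS r `*` erode_T WT t : set T).
Proof.
move=> cW [[x0 s0] [[/= WSx0 _] [/= WTs0 _]]].
have cS : compact WS.
  rewrite (_ : WS = fst @` (WS `*` WT)).
    apply: continuous_compact => //; apply: continuous_subspaceT => x; exact: cvg_fst.
  by apply/seteqP; split => [x Wx|_ [[x s] [/= Wx _] <-]//]; exists (x, s0).
have cT : compact WT.
  rewrite (_ : WT = snd @` (WS `*` WT)).
    apply: continuous_compact => //; apply: continuous_subspaceT => x; exact: cvg_snd.
  by apply/seteqP; split => [s Ws|_ [[x s] [/= _ Ws] <-]//]; exists (x0, s).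
split.
  apply: measurableX.
    apply: measurable_closed_rV; apply: closed_erode_S.
    exact: (compact_closed (@norm_hausdorff R 'rV[R]_d) cS).
  apply: closed_measurable; apply: closed_erode_T.
  exact: (compact_closed (@Rhausdorff R) cT).
have [M hM] := compact_coord_bounded cS.
have /compact_bounded[M' [_ hM']] := cT.
apply: (@st_bounded_coord _ _ _ (Num.max M (M' + 1))) => -[x s] [/= [Wx _] [Ws _]]; split.
  by move=> i; rewrite le_max hM.
by rewrite le_max; apply/orP; right; apply: (hM' (M' + 1)) => //; rewrite ltrDl.
Qed.

End borel_rV.

Section spacetime_integral.
Local Open Scope ereal_scope.
Context (R : realType) (d : nat).
Local Notation T := (spacetime R d).

Lemma integral_restrict_indic (E : set T) (f : T -> \bar R) : 
  \int[@ell R d]_(a in E) f a = \int[@ell R d]_a ((\1_E a)%:E * f a).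
Proof.
rewrite integral_mkcond; apply: eq_integral => a _; rewrite /patch indicE.
by case: ifP => _; rewrite ?mul1e ?mul0e.
Qed.

(** Two almost everywhere values agree because [ell] is not the zero measure. *)
Lemma ae_value_eq (f : T -> \bar R) (c : R) : 0 < @ell R d setT ->
  {ae @ell R d, forall a, f a = c%:E} -> ae_value f = c.
Proof.
move=> ell0 fc; rewrite /ae_value; case: xgetP => [c' _ /= fc'|/(_ c)//].
have [N [mN N0 hN]] := fc; have [N' [mN' N0' hN']] := fc'.
apply: contrapT => cc'; have : @ell R d setT <= 0.
  rewrite -[leRHS](_ : @ell R d (N `|` N') = 0).
    apply: le_measure; [exact/mem_set|by apply/mem_set; exact: measurableU|].
    move=> a _; have [fa|] := pselect (f a = c%:E); last by move=> ?; left; exact: hN.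
    right; apply: hN' => /= fa'; apply: cc'.
    by move: fa'; rewrite fa => -[].
  by rewrite null_set_setU.
by move=> /(lt_le_trans ell0); rewrite ltxx.
Qed.

End spacetime_integral.

(** * Locally finite counting measures and their atoms *)

Section config_kernel.
Context (R : realType) (d : nat).
Local Notation T := (spacetime R d).
Local Notation config := (config R d).

Lemma measurable_config_eval (A : set T) : measurable A ->
  measurable_fun setT (fun phi : config => (phi : lfcm R d) A).
Proof.
move=> mA _ B mB; rewrite setTI; apply: sub_sigma_algebra.
by exists A => //; exists B => //; rewrite setTI.
Qed.

Lemma measurable_to_config dX (X : measurableType dX) (f : X -> config) :
  (forall A, measurable A -> measurable_fun setT (fun x => (f x : lfcm R d) A)) ->
  measurable_fun setT f.
Proof.
move=> mf.
apply: (@measurability _ _ _ _ setT f (@lfcm_evaluations R d)) => //.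
move=> _ [_ [A mA [B mB <-]] <-].
rewrite !setTI.
by have := mf A mA measurableT B mB; rewrite setTI.
Qed.

Lemma nat_cyl_fin (phi : lfcm R d) (A : set T) n : measurable A ->
  exists k : nat, phi (A `&` nat_cyl n) = k%:R%:E.
Proof.
move=> mA; apply: lfcmP; first by apply: measurableI => //; exact: measurable_nat_cyl.
by exists n%:R => z [].
Qed.

Section integral.
Import HBNNSimple.
Context dX (X : measurableType dX).

Let ker (p : X * config) : {measure set T -> \bar R} := (p.2 : lfcm R d).

Let ker_measurable U : measurable U -> measurable_fun setT (ker ^~ U).
Proof.
by move=> mU; apply: (measurableT_comp (measurable_config_eval mU)); exact: measurable_snd.
Qed.

HB.instance Definition _ := isKernel.Build _ _ _ _ R ker ker_measurable.

(** A configuration is not a finite measure and its mass on a bounded set is not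
    uniformly bounded, so it is not a finite kernel; but it is finite on each bounded
    set, which is enough there, and monotone limits along [nat_cyl] do the rest. *)
Lemma measurable_config_section (A : set (X * config * T)) : measurable A ->
  measurable_fun setT (fun p : X * config => (p.2 : lfcm R d) (xsection A p)).
Proof.
move=> mA.
apply: (@emeasurable_fun_cvg _ _ R setT
  (fun n (p : X * config) => (p.2 : lfcm R d) (xsection A p `&` nat_cyl n))).
- move=> n.
  have [] // := @measurable_prod_subset_xsection_kernel _ _ _ _ R ker _ (measurable_nat_cyl n)
    _ _ mA.
  move=> p; have [k kE] := nat_cyl_fin p.2 n measurableT.
  exists (k%:R + 1) => B mB; rewrite /mrestr.
  rewrite (@le_lt_trans _ _ k%:R%:E)//; last by rewrite lte_fin ltrDl.
  rewrite -kE; apply: le_measure.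
  + by apply/mem_set; apply: measurableI => //; exact: measurable_nat_cyl.
  + by apply/mem_set; apply: measurableI => //; exact: measurable_nat_cyl.
  + by move=> z [].
- move=> p _.
  rewrite -[X in _ --> (_ X)]setIT -bigcup_nat_cyl setI_bigcupr.
  apply: (@nondecreasing_cvg_mu _ _ R (p.2 : lfcm R d)).
  + move=> n; apply: measurableI (measurable_nat_cyl n); exact: measurable_xsection.
  + apply: bigcup_measurable => n _; apply: measurableI (measurable_nat_cyl n);
    exact: measurable_xsection.
  + by move=> m n mn; apply/subsetPset; apply: setIS; exact/subsetPset/nd_nat_cyl.
Qed.

Lemma measurable_config_integral (f : X * config * T -> \bar R) :
  (forall z, 0 <= f z)%E -> measurable_fun setT f ->
  measurable_fun setT (fun p : X * config => \int[(p.2 : lfcm R d)]_y f (p, y))%E.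
Proof.
move=> f0 mf.
pose k_ := nnsfun_approx measurableT mf.
apply: (@measurable_fun_xsection_integral _ _ (X * config)%type T R f ker k_).
- by move=> a b ab; exact/nd_nnsfun_approx.
- by move=> z; exact/cvg_nnsfun_approx.
- by move=> n r; apply: measurable_config_section.
Qed.

End integral.

End config_kernel.

Section atoms.
Context (R : realType) (d : nat).
Local Notation T := (spacetime R d).
Local Notation config := (config R d).

Definition coord (o : option 'I_d) (z : T) : measurableTypeR R :=
  if o is Some i then z.1 ord0 i else z.2.

Lemma coord_inj (y z : T) : (forall o, coord o y = coord o z) -> y = z.
Proof.
move: y z => [x s] [x' s'] h; congr pair; last exact: (h None).
by apply/rowP => i; exact: (h (Some i)).
Qed.

Lemma measurable_coord o : measurable_fun setT (coord o).
Proof.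
case: o => [i|] /=; last exact: measurable_snd.
by apply: (measurableT_comp (measurable_coor i)); exact: measurable_fst.
Qed.

(** Indexed by a coordinate and a rational, hence countable, but still enough to
    separate the points of space-time. *)
Definition halfspace (n : nat) : set T :=
  if choice.unpickle n is Some (o, q) then [set z | coord o z <= ratr (q : rat)] else set0.

Lemma measurable_halfspace n : measurable (halfspace n).
Proof.
rewrite /halfspace; case: choice.unpickle => [[c q]|]; last exact: measurable0.
rewrite -[X in measurable X]setTI.
rewrite (_ : [set z | _] = coord c @^-1` `]-oo, (ratr q : R)]).
  by apply: measurable_coord => //; exact: measurable_itv.
by apply/seteqP; split => z /=; rewrite in_itv.
Qed.

Lemma halfspace_sep (y z : T) : y <> z ->
  exists n, halfspace n y /\ ~ halfspace n z \/ halfspace n z /\ ~ halfspace n y.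
Proof.
move=> yz.
have [c oyz] : exists o, coord o y != coord o z.
  by apply: contra_notP yz => /forallNP h; apply: coord_inj => o; exact/eqP/negPn/negP/h.
wlog lt : y z yz oyz / (coord c y < coord c z :> R).
  move: oyz; rewrite neq_lt => /orP[lt|lt] h.
    by apply: h => //; rewrite lt_eqF.
  have [| |n] := h z y _ _ lt; first by apply/nesym.
    by rewrite lt_eqF.
  by exists n; tauto.
have [q] := rat_in_itvoo lt; rewrite in_itv/= => /andP[h1 h2].
exists (choice.pickle (c, q)); left; rewrite /halfspace choice.pickleK /=; split; first exact: ltW.
by apply/negP; rewrite -ltNge.
Qed.

(** Two points differ iff one of countably many half-spaces separates them. *)
Lemma measurable_diag : measurable [set p : T * T | p.1 = p.2].
Proof.
rewrite (_ : mkset _ = ~` \bigcup_n ((halfspace n `*` ~` halfspace n) `|` (~` halfspace n `*`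
  halfspace n))).
  apply: measurableC; apply: bigcup_measurable => n _.
  have mh := measurable_halfspace n; have mh' := measurableC mh.
  by apply: measurableU; apply: measurableX.
apply/seteqP; split => [[y z] /= -> [n _ []] /= []//|[y z] /=].
apply: contra_notP => /halfspace_sep[n h]; exists n => //.
by case: h => h; [left|right]; case: h.
Qed.

(** A measure with values in the natural numbers has no diffuse part. Since values
    can drop only finitely often, there is a piece of positive mass that no measurable
    set splits into two parts of positive mass. Each half-space then carries all or
    none of that mass; removing the countably many null halves leaves a set of full
    mass, which is a single point because the half-spaces separate points. *)
Lemma atom_exists (phi : lfcm R d) (A : set T) n :
  measurable A -> A `<=` nat_cyl n -> phi A != 0%E ->
  exists2 y, A y & (0 < phi [set y])%E.
Proof.
move=> mA An; have [k] : exists k : nat, phi A = k%:R%:E by apply: lfcmP => //; exists n%:R.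
(* Induction on the mass; a splitting set leaves a piece of smaller mass. *)
have [m] := ubnP k; elim: m k A mA An => // k IH a A mA An ak aE A0.
have sub B : measurable B -> (phi (A `&` B) <= phi A)%E by move=> mB; exact: measureIl.
have split B : measurable B -> phi A = (phi (A `&` B) + phi (A `&` ~` B))%E.
  by move=> mB; rewrite -measureU// ?(measurableI, measurableC)//;
    [rewrite -setIUr setUv setIT|exact: measurableI|apply: measurableI => //;
      exact: measurableC|rewrite setIACA setICr setI0].
have [ [B [mB B0 B1]] |] := pselect (exists B, [/\ measurable B,
  phi (A `&` B) != 0%E & phi (A `&` ~` B) != 0%E]).
  have [b bE] : exists b : nat, phi (A `&` B) = b%:R%:E.
    by apply: lfcmP; [exact: measurableI|exists n%:R => z [/An]].
  have [c cE] : exists b : nat, phi (A `&` ~` B) = b%:R%:E.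
    by apply: lfcmP; [apply: measurableI => //; exact: measurableC|exists n%:R => z [/An]].
  have [||y [Ay _] y0] := IH b (A `&` B) (measurableI _ _ mA mB) _ _ bE B0.
  - by move=> z [/An].
  - move: (split _ mB) B1; rewrite bE cE aE -EFinD -natrD => -[] /eqP.
    rewrite eqr_nat eqe pnatr_eq0; lia.
  - by exists y.
move=> /forallNP noB.
(* The union of the null halves of [A]. *)
pose N := \bigcup_m (if phi (A `&` halfspace m) == 0%E then A `&` halfspace m else A `&` ~`
  halfspace m).
have mN m : measurable (if phi (A `&` halfspace m) == 0%E then A `&` halfspace m else A `&` ~`
  halfspace m).
  by have mh := measurable_halfspace m; case: ifP => _; apply: measurableI => //;
    exact: measurableC.
have N0 : phi N = 0%E.
  apply: measure_negligible; first exact: bigcup_measurable.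
  apply: negligible_bigcup => m; apply/negligibleP => //.
  case: ifPn => [/eqP //|h0].
  apply/eqP; apply: contra_notT (noB (halfspace m)) => h1.
  by split => //; exact: measurable_halfspace.
have mNN : measurable N by exact: bigcup_measurable.
have AN : phi (A `&` ~` N) = phi A.
  rewrite (split _ mNN) [X in (X + _)%E](_ : _ = 0%E) ?add0e//.
  by apply/eqP; rewrite eq_le measure_ge0 andbT -N0; apply: measureIr.
have [y [Ay Ny]] : (A `&` ~` N) !=set0.
  by apply/set0P; apply: contra_neq A0 => h; rewrite -AN h measure0.
exists y => //; rewrite lt_neqAle measure_ge0 andbT eq_sym.
apply: contra_neq A0 => y0; apply/eqP; rewrite eq_le measure_ge0 andbT -y0 -AN.
apply: le_measure; [apply/mem_set; apply: measurableI => //; exact: measurableC|apply/mem_set;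
  exact: measurable_spacetime_set1|].
move=> z [Az Nz] /=; apply: contrapT => /halfspace_sep[m h].
case: (eqVneq (phi (A `&` halfspace m)) 0%E) => [m0|m0].
- case: h => -[h1 h2]; [apply: Nz|apply: Ny]; exists m => //; by rewrite m0 eqxx.
- case: h => -[h1 h2]; [apply: Ny|apply: Nz]; exists m => //; by rewrite (negbTE m0).
Qed.

End atoms.

Section points.
Context (R : realType) (d : nat).
Local Notation T := (spacetime R d).
Local Notation config := (config R d).

Lemma point_ge1 (phi : config) y : points phi y -> (1 <= (phi : lfcm R d) [set y])%E.
Proof.
rewrite /points /=.
have [k ->] : exists k : nat, (phi : lfcm R d) [set y] = k%:R%:E.
  apply: lfcmP; first exact: measurable_spacetime_set1.
  have : setT y by [].
  by rewrite -(@bigcup_nat_cyl R d) => -[n _ yn]; exists n%:R => _ ->.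
by rewrite lte_fin lee_fin ltr0n ler1n.
Qed.

Lemma finite_points (phi : config) (A : set T) : st_bounded A -> finite_set (points phi `&` A).
Proof.
move=> [r Ar]; apply: (@sub_finite_set _ _ (points phi `&` cyl r r)).
  by move=> z [? /Ar].
have [k kE] : exists k : nat, (phi : lfcm R d) (cyl r r) = k%:R%:E.
  by apply: lfcmP; [exact: measurable_cyl|exists r].
apply: contrapT => /(@infinite_set_fset _ _ k.+1)[B BA kB].
have mB y : y \in B -> measurable [set y] by move=> _; exact: measurable_spacetime_set1.
have : ((phi : lfcm R d) (\big[setU/set0]_(y <- B) [set y]) <= k%:R%:E)%E.
  rewrite -kE; apply: le_measure; [apply/mem_set|apply/mem_set|].
  - by rewrite big_seq; apply: bigsetU_measurable => y yB; exact: mB.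
  - exact: measurable_cyl.
  - by rewrite -bigcup_seq => z [y /BA[_ h] ->].
apply/negP; rewrite -ltNge measure_fbigsetU//; last first.
  by apply/trivIsetP => i j _ _ ij; rewrite -subset0 => z [/= -> ij']; rewrite ij' eqxx in ij.
apply: (@lt_le_trans _ _ (\sum_(y <- B) 1%:E)%E).
  by rewrite sumEFin lte_fin big_const_seq count_predT iter_addr_0 ltr_nat.
rewrite big_seq [leRHS]big_seq; apply: lee_sum => y /BA[py _].
exact: point_ge1.
Qed.

Lemma countable_points (phi : config) : countable (points phi).
Proof.
rewrite -[points phi]setIT -(@bigcup_nat_cyl R d) setI_bigcupr.
apply: bigcup_countable => // n _; apply: finite_set_countable.
by apply: finite_points; exact: st_bounded_nat_cyl.
Qed.

Lemma integral_singleton (phi : lfcm R d) (f : T -> \bar R) (y : T) :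
  (0 <= f y)%E ->
  (\int[phi]_(z in [set y]) f z = f y * phi [set y])%E.
Proof.
move=> fy0.
rewrite (eq_integral (cst (f y))) ?integral_cst//.
- exact: measurable_spacetime_set1.
- by move=> z /set_mem ->.
Qed.

(** Locally finite counting measures are purely atomic, by [atom_exists]; the atoms
    are countably many, so the integral is the sum over them. *)
Lemma config_integralE (phi : config) (f : T -> \bar R) :
  measurable_fun setT f -> (forall y, 0 <= f y)%E ->
  (\int[phi : lfcm R d]_y f y =
   \esum_(y in points phi) (f y * (phi : lfcm R d) [set y]))%E.
Proof.
move=> mf f0.
(* An enumeration of the atoms cuts them into sets [F n] with at most one element. *)
have /countable_injP[e einj] := countable_points phi.
pose F n := points phi `&` [set y | e y = n].
have FE : points phi = \bigcup_n F n.
  by rewrite /F -setI_bigcupr; apply/seteqP; split => y; [move=> py; split => //;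
    exists (e y)|case].
have F01 n : F n = set0 \/ exists2 y, points phi y & F n = [set y].
  have [->|/set0P[y [py yn]]] := eqVneq (F n) set0; [by left|right].
  exists y => //; apply/seteqP; split => [z [pz zn]|_ ->//].
  by apply: einj; [exact: mem_set|exact: mem_set|rewrite yn].
have mF n : measurable (F n).
  by have [->|[y _ ->]] := F01 n; [exact: measurable0|exact: measurable_spacetime_set1].
have tF : trivIset setT F.
  by apply/trivIsetP => i j _ _ ij; rewrite -subset0 => z [[_ /= h1] [_ /= h2]];
    rewrite -h1 -h2 eqxx in ij.
have mp : measurable (points phi) by rewrite FE; exact: bigcup_measurable.
rewrite (@ge0_negligible_integral _ _ _ (phi : lfcm R d) setT (~` points phi))//; last 2 first.
- exact: measurableC.
- rewrite -[~` _]setIT -(@bigcup_nat_cyl R d) setI_bigcupr.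
  apply: measure_negligible.
    apply: bigcup_measurable => n _; apply: measurableI; first exact: measurableC.
    exact: measurable_nat_cyl.
  have mm n : measurable (~` points phi `&` nat_cyl n).
    by apply: measurableI; [exact: measurableC|exact: measurable_nat_cyl].
  apply: negligible_bigcup => n; apply/negligibleP => //.
  apply/eqP; apply: contraT => phi0.
  have sub : ~` points phi `&` nat_cyl n `<=` nat_cyl n by move=> z [].
  by have [y [npy _] y0] := atom_exists (mm n) sub phi0; exfalso; apply: npy.
rewrite setTD setCK FE ge0_integral_bigcup//; last exact: measurable_funTS.
rewrite esum_bigcupT//; last by move=> x; rewrite mule_ge0.
rewrite nneseries_esumT; last by move=> n; apply: integral_ge0.
apply: eq_esum => n _; have [->|[y _ ->]] := F01 n.
  by rewrite integral_set0 esum_set0.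
by rewrite integral_singleton// esum_set1// mule_ge0.
Qed.

Lemma removeE (phi : config) y A :
  (remove phi y : lfcm R d) A = (phi : lfcm R d) (A `&` ~` [set y]).
Proof. by []. Qed.

Lemma points_remove (phi : config) y : points (remove phi y) = points phi `\ y.
Proof.
apply/seteqP; split => z; rewrite /points /= removeE.
  have [->|/eqP zy] := eqVneq z y; first by rewrite setICr measure0 ltxx.
  by rewrite setIidl// => _ ->.
by case=> pz zy; rewrite setIidl// => _ ->.
Qed.

Section measurability.
Context dX (X : measurableType dX).

Lemma measurable_atom :
  measurable_fun setT (fun p : config * T => (p.1 : lfcm R d) [set p.2]).
Proof.
pose A := (fun p : T * config * T => (p.1.1, p.2)) @^-1` [set p : T * T | p.1 = p.2].
have mA : measurable A.
  rewrite -[X in measurable X]setTI.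
  have mf : measurable_fun setT (fun p : T * config * T => (p.1.1, p.2)).
    apply: measurable_fun_pair; last exact: measurable_snd.
    by apply: (measurableT_comp measurable_fst); exact: measurable_fst.
  by apply: mf => //; exact: measurable_diag.
have ms : measurable_fun setT (fun p : config * T => (p.2, p.1)).
  by apply: measurable_fun_pair; [exact: measurable_snd|exact: measurable_fst].
apply: eq_measurable_fun (measurableT_comp (measurable_config_section mA) ms).
move=> [phi y] _ /=; congr (_ _).
by apply/seteqP; split => z; rewrite /xsection /A /=; [move=> /set_mem /= ->|move=> ->;
  exact/mem_set].
Qed.

Lemma measurable_remove :
  measurable_fun setT (fun p : config * T => remove p.1 p.2).
Proof.
apply: measurable_to_config => B mB.
pose A := (fun p : T * config * T => (p.1.1, p.2)) @^-1` (~` [set p : T * T | p.1 = p.2])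
   `&` (snd @^-1` B).
have mA : measurable A.
  apply: measurableI; rewrite -[X in measurable X]setTI.
    have mf : measurable_fun setT (fun p : T * config * T => (p.1.1, p.2)).
      apply: measurable_fun_pair; last exact: measurable_snd.
      by apply: (measurableT_comp measurable_fst); exact: measurable_fst.
    by apply: mf => //; apply: measurableC; exact: measurable_diag.
  exact: measurable_snd.
have ms : measurable_fun setT (fun p : config * T => (p.2, p.1)).
  by apply: measurable_fun_pair; [exact: measurable_snd|exact: measurable_fst].
apply: eq_measurable_fun (measurableT_comp (measurable_config_section mA) ms).
move=> [phi y] _ /=; rewrite /mrestr; congr (_ _).
apply/seteqP; split => z; rewrite /xsection /A /=.
  by move=> /set_mem [yz Bz]; split => // yz'; exact: yz.
by move=> [Bz yz]; apply/mem_set; split => // zy; exact: yz.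
Qed.

(** Points are counted without multiplicity, whereas integration against [phi] counts
    them with multiplicity. Dividing by the jointly measurable mass [phi [set y]] turns
    the sum over points into such an integral. *)
Lemma measurable_esum_points (f : X * config * T -> \bar R) :
  (forall z, 0 <= f z)%E -> measurable_fun setT f ->
  measurable_fun setT (fun p : X * config => \esum_(y in points p.2) f (p, y))%E.
Proof.
move=> f0 mf.
pose at_ (p : X * config * T) := (p.1.2 : lfcm R d) [set p.2].
have mat : measurable_fun setT at_.
  have ms : measurable_fun setT (fun p : X * config * T => (p.1.2, p.2)).
    apply: measurable_fun_pair; last exact: measurable_snd.
    by apply: (measurableT_comp measurable_snd); exact: measurable_fst.
  exact: (measurableT_comp measurable_atom ms).
(* Masses are nonnegative, so that the power [-1] is the inverse. *)
pose g p := (f p * (fine (at_ p) `^ (-1))%:E)%E.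
have g0 p : (0 <= g p)%E by rewrite mule_ge0// lee_fin powR_ge0.
have mg : measurable_fun setT g.
  apply: emeasurable_funM => //; apply/measurable_EFinP.
  apply: (measurableT_comp (measurable_powR _)).
  exact: measurableT_comp.
apply: eq_measurable_fun (measurable_config_integral g0 mg) => -[x phi] _ /=.
rewrite config_integralE//; last exact: measurable_fun_pair2.
apply: eq_esum => y py.
have y1 := point_ge1 py.
have : (phi : lfcm R d) [set y] != +oo%E.
  have [k ->//] : exists k : nat, (phi : lfcm R d) [set y] = k%:R%:E.
  apply: lfcmP; first exact: measurable_spacetime_set1.
  have : setT y by [].
  by rewrite -(@bigcup_nat_cyl R d) => -[n _ yn]; exists n%:R => _ ->.
rewrite /g /at_ /=; move: y1; case: ((phi : lfcm R d) [set y]) => // s; rewrite lee_fin => s1 _.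
rewrite /= powR_inv1 ?(le_trans _ s1)// -muleA -EFinM mulVf ?mule1//.
by rewrite gt_eqF// (lt_le_trans _ s1).
Qed.

End measurability.
End points.

(** * Sums over tuples of distinct points *)

Section esum_extra.
Context (R : realType) (T : choiceType).
Implicit Types (I : set T) (a : T -> \bar R).

Lemma esumZl I a (c : R) : 0 <= c -> (forall i, 0 <= a i)%E ->
  (\esum_(i in I) (c%:E * a i) = c%:E * \esum_(i in I) a i)%E.
Proof.
move=> c0 a0.
have le (b : T -> \bar R) (e : R) : 0 <= e -> (forall i, 0 <= b i)%E ->
    (\esum_(i in I) (e%:E * b i) <= e%:E * \esum_(i in I) b i)%E.
  move=> e0 b0; apply: ge_ereal_sup => _ [A [finA AI] <-].
  rewrite fsbig_finite//= -ge0_sume_distrr//.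
  apply: lee_wpmul2l; first by rewrite lee_fin.
  apply: ereal_sup_ubound; exists A; first by split.
  by rewrite fsbig_finite.
apply/eqP; rewrite eq_le le//=.
have [->|c_neq0] := eqVneq c 0.
  by rewrite mul0e; apply: esum_ge0 => i _; rewrite mul0e.
have cV : (c%:E * c^-1%:E = 1)%E by rewrite -EFinM divff.
rewrite -[leRHS]mul1e -cV -muleA; apply: lee_wpmul2l; first by rewrite lee_fin.
rewrite -[X in (X <= _)%E](_ : \esum_(i in I) (c^-1%:E * (c%:E * a i)) = _)%E.
  by apply: le; rewrite ?invr_ge0// => i; rewrite mule_ge0.
by apply: eq_esum => i _; rewrite muleA -EFinM mulVf ?mul1e.
Qed.

Lemma esum_seq I (s : seq T) a : uniq s -> (forall i, 0 <= a i)%E ->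
  (forall i, i \in s -> I i) -> (forall i, I i -> i \notin s -> a i = 0%E) ->
  (\esum_(i in I) a i = \sum_(i <- s) a i)%E.
Proof.
move=> us a0 sI sa.
rewrite [RHS]fsbig_seq// -esum_fset//.
rewrite (_ : [set` s] = I `&` [set` s]).
  rewrite esum_mkcondr; apply: eq_esum => i Ii.
  by case: ifPn => // h; apply: sa => //; apply: contra h => h; exact/mem_set.
by apply/seteqP; split => [i /= h|i []//]; split => //; exact: sI.
Qed.

End esum_extra.

Section elementary.
Context (R : realType) (T : choiceType) (u : T -> R).

(** For duplicate-free [s], the sum over the ordered [n]-tuples of distinct elements of
    [s] of the product of [u]; that is, [n!] times the [n]-th elementary symmetric polynomial. *)
Fixpoint distinct_sum n (s : seq T) : R :=
  if n is m.+1 then \sum_(y <- s) u y * distinct_sum m (rem y s) else 1.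

(** The element [x] is absent from the tuple, or occupies one of its [n+1] places. *)
Lemma distinct_sum_cons n x s : uniq (x :: s) ->
  distinct_sum n.+1 (x :: s) = distinct_sum n.+1 s + n.+1%:R * (u x * distinct_sum n s).
Proof.
elim: n x s => [|n IH] x s us.
  by rewrite /= !big_cons mul1r addrC.
have [xs us'] := andP us.
rewrite [LHS]/= big_cons eqxx -/(distinct_sum n.+1 s).
rewrite (_ : \sum_(y <- s) _ = \sum_(y <- s) (u y * distinct_sum n.+1 (rem y s) + n.+1%:R * u x
  * (u y * distinct_sum n (rem y s)))).
  rewrite big_split/= -mulr_sumr -/(distinct_sum n.+1 s) -/(distinct_sum n.+2 s).
  rewrite [in RHS]mulrSr; ring.
rewrite big_seq [RHS]big_seq; apply: eq_bigr => y ys.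
have xy : x != y by apply: contraNneq xs => ->.
rewrite (negbTE xy) -[in LHS]/(distinct_sum n.+1 (x :: rem y s)) IH; first by ring.
by rewrite /= rem_uniq// andbT; apply: contra xs; exact: mem_rem.
Qed.

Lemma prod_distinct_sum s N : uniq s -> (size s < N)%N ->
  \prod_(y <- s) (1 - u y) = \sum_(n < N) (-1) ^+ n / n`!%:R * distinct_sum n s.
Proof.
elim: s N => [|x s IH] [//|N] us sN.
  rewrite big_nil big_ord_recl big1 /=; last by move=> i _; rewrite big_nil mulr0.
  by rewrite fact0 expr0 invr1 !mulr1 addr0.
have [xs us'] := andP us.
rewrite big_cons mulrBl mul1r {1}(IH N.+1)//; last exact: ltnW.
rewrite (IH N)// [RHS]big_ord_recl [X in X - _]big_ord_recl -addrA; congr +%R.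
under [in RHS]eq_bigr => i _.
  rewrite (_ : _ * _ = (-1) ^+ lift ord0 i / (lift ord0 i)`!%:R * distinct_sum (lift ord0 i) s
    - u x * ((-1) ^+ i / i`!%:R * distinct_sum i s)); last first.
    rewrite lift0 distinct_sum_cons// mulrDr; congr +%R.
    rewrite factS natrM exprS.
    have f0 : i`!%:R != 0 :> R by rewrite pnatr_eq0 -lt0n fact_gt0.
    have i0 : i.+1%:R != 0 :> R by rewrite pnatr_eq0.
    by field; rewrite f0 addrC natr1 i0.
  over.
by rewrite big_split/= sumrN -mulr_sumr.
Qed.

End elementary.

Section distinct.
Context (R : realType) (d : nat).
Local Notation T := (spacetime R d).
Local Notation config := (config R d).

Lemma esum_distinct0 (phi : config) (h : 0.-tuple T -> \bar R) : (forall z, 0 <= h z)%E ->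
  (\esum_(z in distinct_tuples phi 0) h z = h [tuple])%E.
Proof.
move=> h0; rewrite (_ : distinct_tuples phi 0 = [set [tuple]]) ?esum_set1//.
apply/seteqP; split => z; first by move=> _ /=; rewrite (tuple0 z).
by move=> ->; split => // -[].
Qed.

(** An ordered tuple of distinct points is a first point, followed by a tuple of
    distinct points of the configuration from which it is removed. All facts on sums
    over distinct tuples follow from this recursion. *)
Lemma esum_distinctS (phi : config) n (h : n.+1.-tuple T -> \bar R) : (forall z, 0 <= h z)%E ->
  (\esum_(z in distinct_tuples phi n.+1) h z =
   \esum_(y in points phi) \esum_(z in distinct_tuples (remove phi y) n) h (cons_pair (y, z)))%E.
Proof.
move=> h0; rewrite esum_esum//.
rewrite (@reindex_esum _ _ _ (points phi `*`` (fun y =>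
  distinct_tuples (remove phi y) n)) _ (@cons_pair _ T n)).
  by apply: eq_esum => -[y z].
split.
- move=> [y z] /= [py [uz pz]]; split => /=.
    rewrite uz andbT; apply/negP => /tnthP[i yi].
    by have := pz i; rewrite points_remove => -[_]; apply.
  move=> i; case: (unliftP ord0 i) => [j ->|->]; rewrite ?tnth0//.
  rewrite tnthS; have := pz j; rewrite points_remove => -[pj _].
  by move: pj; rewrite (_ : tnth z j = tnth [tuple of z] j)//; congr (tnth _ _); apply: val_inj.
- move=> p q _ _; exact: (can_inj (@cons_pairK _ T n)).
- move=> z [uz pz]; exists (uncons_pair z).
    move: z uz pz => /tupleP[y z] /= /andP[yz uz] pz; split => /=.
      by have := pz ord0; rewrite tnth0 /thead.
    split; first by [].
    move=> i; rewrite points_remove; split.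
      have := pz (lift ord0 i); rewrite tnthS; congr points; congr tnth; exact: val_inj.
    move=> /= e; move/negP: yz; apply; apply/tnthP; exists i.
    rewrite -[y]/(thead [tuple of y :: z]) -e; congr tnth; exact: val_inj.
  by apply: val_inj; case/tupleP: z {uz pz} => y z.
Qed.

Lemma measurable_esum_distinct n dX (X : measurableType dX) (h : X * n.-tuple T -> \bar R) :
  (forall z, 0 <= h z)%E -> measurable_fun setT h ->
  measurable_fun setT (fun p : X * config => \esum_(z in distinct_tuples p.2 n) h (p.1, z))%E.
Proof.
elim: n dX X h => [|n IH] dX X h h0 mh.
  apply: (@eq_measurable_fun _ _ _ _ _ (fun p : X * config => h (p.1, [tuple]))).
    by move=> p _; rewrite esum_distinct0.
  have ms : measurable_fun setT (fun p : X * config => (p.1, [tuple] : 0.-tuple T)).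
    by apply: measurable_fun_pair; [exact: measurable_fst|exact: measurable_cst].
  exact: (measurableT_comp mh ms).
pose g (p : X * T * n.-tuple T) := h (p.1.1, cons_pair (p.1.2, p.2)).
have mg : measurable_fun setT g.
  apply: (measurableT_comp mh); apply: measurable_fun_pair.
    by apply: (measurableT_comp measurable_fst); exact: measurable_fst.
  apply: (measurableT_comp (@measurable_cons_pair _ T n)); apply: measurable_fun_pair;
    last exact: measurable_snd.
  by apply: (measurableT_comp measurable_snd); exact: measurable_fst.
have g0 z : (0 <= g z)%E by exact: h0.
have mk := IH _ _ g g0 mg.
pose f (p : X * config * T) := (\esum_(z in distinct_tuples (remove p.1.2 p.2) n) g (p.1.1,
  p.2, z))%E.
have mf : measurable_fun setT f.
  have ms : measurable_fun setT (fun p : X * config * T => ((p.1.1, p.2), remove p.1.2 p.2)).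
    apply: measurable_fun_pair.
      apply: measurable_fun_pair; last exact: measurable_snd.
      by apply: (measurableT_comp measurable_fst); exact: measurable_fst.
    have ms : measurable_fun setT (fun p : X * config * T => (p.1.2, p.2)).
      apply: measurable_fun_pair; last exact: measurable_snd.
      by apply: (measurableT_comp measurable_snd); exact: measurable_fst.
    exact: (measurableT_comp (@measurable_remove R d) ms).
  exact: (measurableT_comp mk ms).
have f0 z : (0 <= f z)%E by apply: esum_ge0.
apply: eq_measurable_fun (measurable_esum_points f0 mf) => -[x phi] _ /=.
by rewrite esum_distinctS.
Qed.

End distinct.

Section factorial_sums.
Context (R : realType) (d : nat).
Local Notation T := (spacetime R d).
Local Notation config := (config R d).
Variable u : T -> R.
Hypothesis u0 : forall y, 0 <= u y.

Lemma prod_weight_ge0 (z : seq T) : 0 <= \prod_(y <- z) u y.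
Proof. by apply: prodr_ge0 => y _. Qed.

Lemma esum_distinct_prod n (phi : config) s : uniq s ->
  (forall y, y \in s -> points phi y) ->
  (forall y, points phi y -> y \notin s -> u y = 0) ->
  (\esum_(z in distinct_tuples phi n) (\prod_(y <- z) u y)%:E)%E = (distinct_sum u n s)%:E.
Proof.
elim: n phi s => [|n IH] phi s us sp pu.
  rewrite esum_distinct0 ?big_nil// => z; rewrite lee_fin; exact: prod_weight_ge0.
rewrite esum_distinctS; last by move=> z; rewrite lee_fin prod_weight_ge0.
under eq_esum => y py.
  under eq_esum => z _ do rewrite /= big_cons EFinM.
  rewrite esumZl//; last by move=> z; rewrite lee_fin prod_weight_ge0.
  over.
rewrite (@esum_seq _ _ _ s)//; first last.
- by move=> y py ys; rewrite (pu y)// mul0e.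
- by move=> y; rewrite mule_ge0// ?lee_fin//; apply: esum_ge0 => z _;
  rewrite lee_fin prod_weight_ge0.
rewrite /= -sumEFin big_seq [RHS]big_seq; apply: eq_bigr => y ys.
rewrite EFinM; congr *%E; apply: IH.
- exact: rem_uniq.
- move=> x; rewrite mem_rem_uniq// inE => /andP[/eqP xy xs].
  by rewrite points_remove; split => //; exact: sp.
- move=> x; rewrite points_remove => -[px /= xy].
  rewrite mem_rem_uniq// inE negb_and negbK => /orP[/eqP //|]; exact: pu.
Qed.

Definition factorial_sum n (phi : config) : \bar R :=
  (\esum_(z in distinct_tuples phi n) (\prod_(y <- z) u y)%:E)%E.

Lemma factorial_sum_ge0 n phi : (0 <= factorial_sum n phi)%E.
Proof. by apply: esum_ge0 => z _; rewrite lee_fin prod_weight_ge0. Qed.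

(** Only the finitely many points in [A] contribute, and for finitely many factors
    the product of the [1 - u y] is the alternating sum of the elementary symmetric
    polynomials. *)
Lemma generating_product_expansion (A : set T) (phi : config) : st_bounded A ->
  (forall y, ~ A y -> u y = 0) ->
  exists2 x : nat -> R, (forall n, factorial_sum n phi = (x n)%:E) &
   exists k, forall N, (k <= N)%N ->
    generating_product u phi = \sum_(n < N) (-1) ^+ n / n`!%:R * x n.
Proof.
move=> bA uA; have fA := finite_points phi bA.
pose s : seq T := fset_set (points phi `&` A).
have us : uniq s by exact: fset_uniq.
have sP y : (y \in s) <-> (points phi `&` A) y.
  by rewrite /s in_fset_set//; split => [/set_mem|/mem_set].
exists (distinct_sum u ^~ s) => [n|].
  apply: esum_distinct_prod => // [y /sP[]//|y py /negP ys].
  by apply: uA => Ay; apply: ys; apply/sP.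
exists (size s).+1 => N sN; rewrite -prod_distinct_sum//.
rewrite /generating_product -(fsbig_widen (points phi `&` A) (points phi)).
- by rewrite [LHS]fsbig_finite.
- by move=> y [].
- by move=> y [py nAy] /=; rewrite uA ?subr0// => Ay; apply: nAy.
Qed.

End factorial_sums.

Section exchange.
Local Open Scope ereal_scope.
Context dO (Om : measurableType dO) (R : realType) (mu : {measure set Om -> \bar R}).

(** Dominated convergence: the partial sums of [p] are bounded by the series of the
    [xe n / n!], which is integrable when the [c n / n!] are summable. So the integral of
    [p] is a function of the moments [c n] alone. This is how the constancy of moments
    becomes constancy of expected products. *)
Lemma integral_alternating (p : Om -> R) (xe : nat -> Om -> \bar R) (c : nat -> R) :
  (forall n, measurable_fun setT (xe n)) -> (forall n w, 0 <= xe n w) ->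
  (forall w, exists2 x : nat -> R, (forall n, xe n w = (x n)%:E) &
     exists k, forall N, (k <= N)%N ->
       p w = (\sum_(n < N) (-1) ^+ n / n`!%:R * x n)%R) ->
  (forall n, \int[mu]_w xe n w = (c n)%:E) ->
  \sum_(n <oo) (c n / n`!%:R)%:E < +oo ->
  measurable_fun setT p /\
  \int[mu]_w (p w)%:E = limn (fun N => (\sum_(n < N) (-1) ^+ n / n`!%:R * c n)%:E) /\
  mu.-integrable setT (EFin \o p).
Proof.
move=> mx x0 px ic sc.
pose x n w := fine (xe n w).
have xE n w : xe n w = (x n w)%:E by rewrite /x; have [x' ->] := px w.
have xr0 n w : (0 <= x n w)%R by rewrite -lee_fin -xE.
have pE w : exists k, forall N, (k <= N)%N -> p w = (\sum_(n < N) (-1) ^+ n / n`!%:R * x n w)%R.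
  have [x' x'E [k kE]] := px w; exists k => N /kE ->.
  by apply: eq_bigr => n _; rewrite /x x'E.
have mxr n : measurable_fun setT (x n).
  by apply/measurable_EFinP; apply: eq_measurable_fun (mx n) => w _; rewrite /= -xE.
pose f N w := (\sum_(n < N) (-1) ^+ n / n`!%:R * x n w)%:E.
have mf N : measurable_fun setT (f N).
  apply/measurable_EFinP; apply: measurable_sum => n.
  by apply: measurable_funM => //; exact: measurable_cst.
have fp w : f ^~ w @ \oo --> (p w)%:E.
  have [k kE] := pE w.
  apply: cvg_near_cst; exists k => // N /= kN; apply/eqP; by rewrite /f -kE.
have mp : measurable_fun setT (EFin \o p).
  by apply: (emeasurable_fun_cvg f) => // w _; exact: fp.
pose g w := \sum_(n <oo) (x n w / n`!%:R)%:E.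
have t0 n w : 0 <= (x n w / n`!%:R)%:E by rewrite lee_fin divr_ge0.
have mt n : measurable_fun setT (fun w => (x n w / n`!%:R)%:E).
  by apply/measurable_EFinP; apply: measurable_funM => //; exact: measurable_cst.
have g0 w : 0 <= g w by apply: nneseries_ge0 => n _ _.
have mg : measurable_fun setT g by apply: ge0_emeasurable_sum => // n _.
have ig : mu.-integrable setT g.
  apply/integrableP; split => //.
  rewrite (eq_integral g); last by move=> w _; rewrite gee0_abs.
  rewrite integral_nneseries//.
  rewrite (eq_eseriesr (g := fun n => (c n / n`!%:R)%:E))// => n _.
  under eq_integral do rewrite mulrC EFinM -xE.
  by rewrite ge0_integralZl// ?ic ?lee_fin// -EFinM mulrC.
have fg w n : `|f n w| <= g w.
  apply: (@le_trans _ _ (\sum_(i < n) (x i w / i`!%:R)%:E)).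
    rewrite /f sumEFin lee_fin (le_trans (ler_norm_sum _ _ _))//.
    apply: ler_sum => i _; rewrite normrM (ger0_norm (xr0 _ _)) mulrC ler_wpM2l//.
    by rewrite normrM normrX normrN1 expr1n mul1r ger0_norm// invr_ge0.
  rewrite -(big_mkord xpredT (fun i => (x i w / i`!%:R)%:E)).
  exact: nneseries_lim_ge.
have [ip _ cp] := @dominated_convergence _ _ _ mu setT measurableT f (EFin \o p) g mf mp
   (aeW _ (fun w _ => fp w)) ig (aeW _ (fun w n _ => fg w n)).
split; [exact/measurable_EFinP|split => //].
rewrite -[LHS](cvg_lim _ cp)//; congr (limn _); apply/funext => N.
have ixe n : mu.-integrable setT (xe n).
  apply/integrableP; split => //.
  by rewrite (eq_integral (xe n)) ?ic ?ltry// => w _; rewrite gee0_abs.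
rewrite /= (eq_integral (fun w => \sum_(n < N) ((-1) ^+ n / n`!%:R)%:E * xe n w)); last first.
  by move=> w _; rewrite /f -sumEFin; apply: eq_bigr => n _; rewrite xE -EFinM.
rewrite integral_sum//; last by move=> n; exact: integrableZl.
rewrite -sumEFin; apply: eq_bigr => n _.
by rewrite integralZl// ic.
Qed.

End exchange.

(** * Integrals over tuples *)

Section tuple_integral.
Local Open Scope ereal_scope.
Context dT (T : measurableType dT) (R : realType).
Variable mu : {sigma_finite_measure set T -> \bar R}.

Lemma measurable_fun_tuple0 d' (X : measurableType d') (h : 0.-tuple T -> X) :
  measurable_fun setT h.
Proof.
apply: (@eq_measurable_fun _ _ _ _ _ (cst (h [tuple]))) => [z _|]; first by rewrite (tuple0 z).
exact: measurable_cst.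
Qed.

Lemma integral_tuple0 (h : 0.-tuple T -> \bar R) :
  \int[tuple_measure mu 0]_z h z = h [tuple].
Proof.
rewrite /= integral_dirac// ?diracT ?mul1e//.
exact: measurable_fun_tuple0.
Qed.

Lemma measurable_fun_cons_pair n d' (X : measurableType d') (h : n.+1.-tuple T -> X) :
  measurable_fun setT h -> measurable_fun setT (fun p : T * n.-tuple T => h (cons_pair p)).
Proof. by move=> mh; apply: (measurableT_comp mh); exact: measurable_cons_pair. Qed.

Lemma integral_tupleS n (h : n.+1.-tuple T -> \bar R) :
  measurable_fun setT h -> (forall z, 0 <= h z) ->
  \int[tuple_measure mu n.+1]_z h z =
  \int[mu]_x \int[tuple_measure mu n]_z h (cons_pair (x, z)).
Proof.
move=> mh h0; rewrite /= ge0_integral_pushforward//; last exact: measurable_cons_pair.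
rewrite preimage_setT.
rewrite -[LHS]/(\int[(mu \x tuple_measure mu n)%E]_p (h \o @cons_pair _ T n) p).
rewrite fubini_tonelli1//; first exact: measurable_fun_cons_pair.
by move=> p; exact: h0.
Qed.

Lemma measurable_integral_tuple n (h : n.+1.-tuple T -> \bar R) :
  measurable_fun setT h -> (forall z, 0 <= h z) ->
  measurable_fun setT (fun x => \int[tuple_measure mu n]_z h (cons_pair (x, z))).
Proof.
move=> mh h0.
exact: (@measurable_fun_fubini_tonelli_F _ _ _ _ _ (tuple_measure mu n)
  (fun p => h (cons_pair p)) (measurable_fun_cons_pair mh)).
Qed.

Definition tuple_map n (tau : nat -> T -> T) (z : n.-tuple T) : n.-tuple T :=
  [tuple tau i (tnth z i) | i < n].

Lemma measurable_tuple_map n tau : (forall i, measurable_fun setT (tau i)) ->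
  measurable_fun setT (@tuple_map n tau).
Proof.
move=> mt; apply/measurable_fun_tnthP => i.
rewrite (_ : _ \o _ = fun z => tau i (tnth z i)).
  by apply: (measurableT_comp (mt i)); exact: measurable_tnth.
by apply/funext => z /=; rewrite tnth_mktuple.
Qed.

(** The maps may differ from one coordinate to the next, which is what translating
    a row vector needs. *)
Lemma integral_tuple_map n (tau : nat -> T -> T) (h : n.-tuple T -> \bar R) :
  (forall i, measurable_fun setT (tau i)) ->
  (forall i f, measurable_fun setT f -> (forall x, 0 <= f x) ->
     \int[mu]_x f (tau i x) = \int[mu]_x f x) ->
  measurable_fun setT h -> (forall z, 0 <= h z) ->
  \int[tuple_measure mu n]_z h (tuple_map tau z) = \int[tuple_measure mu n]_z h z.
Proof.
elim: n tau h => [|n IH] tau h mt ti mh h0.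
  by rewrite !integral_tuple0 (tuple0 (tuple_map _ _)).
have mht : measurable_fun setT (fun z => h (tuple_map tau z)).
  by apply: (measurableT_comp mh); exact: measurable_tuple_map.
rewrite !integral_tupleS//.
rewrite -[RHS](ti 0%N); last 2 first.
- exact: measurable_integral_tuple.
- by move=> x; apply: integral_ge0.
apply: eq_integral => x _.
rewrite -[RHS](IH (fun i => tau i.+1) (fun z => h (cons_pair (tau 0%N x, z)))); first last.
- by [].
- exact: (measurable_fun_pair2 (tau 0%N x) (measurable_fun_cons_pair mh)).
- by move=> i; exact: ti.
- by move=> i; exact: mt.
apply: eq_integral => z _; congr h; apply: eq_from_tnth => i.
rewrite tnth_mktuple; case: (unliftP ord0 i) => [j ->|->]; last by rewrite !tnth0.
rewrite !tnthS.
rewrite [RHS](_ : _ = tnth (tuple_map (fun i => tau i.+1) z) j); last first.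
  by congr tnth; exact: val_inj.
rewrite tnth_mktuple lift0; congr (tau _ _).
Qed.

(** Functions of all finite sequences at once, rather than of tuples of one length,
    spare casts between lengths when a sequence is split by a mask. *)
Definition seq_measurable d' (X : measurableType d') (h : seq T -> X) :=
  forall n, measurable_fun setT (fun z : n.-tuple T => h z).

Definition int_seq n (h : seq T -> \bar R) := \int[tuple_measure mu n]_z h z.

Lemma seq_measurable_cons d' (X : measurableType d') (h : seq T -> X) x :
  seq_measurable h -> seq_measurable (fun s => h (x :: s)).
Proof.
move=> mh n; exact: (measurable_fun_pair2 x (measurable_fun_cons_pair (mh n.+1))).
Qed.

Lemma int_seq0 h : int_seq 0 h = h [::].
Proof. exact: integral_tuple0. Qed.

Lemma int_seqS n h : seq_measurable h -> (forall s, 0 <= h s) ->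
  int_seq n.+1 h = \int[mu]_x int_seq n (fun s => h (x :: s)).
Proof. by move=> mh h0; rewrite /int_seq integral_tupleS//; exact: mh. Qed.

Lemma measurable_int_seq n h : seq_measurable h -> (forall s, 0 <= h s) ->
  measurable_fun setT (fun x => int_seq n (fun s => h (x :: s))).
Proof. move=> mh h0; exact: (measurable_integral_tuple (mh n.+1)). Qed.

Lemma int_seq_ge0 n h : (forall s, 0 <= h s) -> 0 <= int_seq n h.
Proof. by move=> h0; exact: integral_ge0. Qed.

Lemma measurable_mask n (m : bitseq) :
  exists k (f : n.-tuple T -> k.-tuple T), measurable_fun setT f /\
    forall z, f z = mask m z :> seq T.
Proof.
elim: m n => [|b m IH] n; first by exists 0%N, (fun=> [tuple]); split.
case: n => [|n].
  exists 0%N, (fun=> [tuple]); split; first exact: measurable_cst.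
  by move=> z; rewrite (tuple0 z); case: b.
have [k [f [mf fE]]] := IH n.
have mu_ : measurable_fun setT (fun z : n.+1.-tuple T => f (uncons_pair z).2).
  apply: (measurableT_comp mf); apply: (measurableT_comp measurable_snd).
  exact: measurable_uncons_pair.
case: b; last first.
  exists k, (fun z => f (uncons_pair z).2); split => // z.
  by rewrite fE /=; case/tupleP: z => x z.
exists k.+1, (fun z => cons_pair ((uncons_pair z).1, f (uncons_pair z).2)); split.
  apply: (measurableT_comp (@measurable_cons_pair _ T k)).
  apply: measurable_fun_pair => //; apply: (measurableT_comp measurable_fst).
  exact: measurable_uncons_pair.
by move=> z; rewrite /= fE /=; case/tupleP: z => x z /=; rewrite /thead tnth0.
Qed.

Lemma seq_measurable_mask d' (X : measurableType d') (h : seq T -> X) m :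
  seq_measurable h -> seq_measurable (fun s => h (mask m s)).
Proof.
move=> mh n; have [k [f [mf fE]]] := measurable_mask n m.
apply: eq_measurable_fun (measurableT_comp (mh k) mf) => z _ /=.
by rewrite fE.
Qed.

(** Fubini: the coordinates selected by [m] and the remaining ones are independent
    under the product measure, whatever their order. *)
Lemma int_seq_mask m F G : seq_measurable F -> (forall s, 0 <= F s) ->
  seq_measurable G -> (forall s, 0 <= G s) ->
  int_seq (size m) (fun s => F (mask m s) * G (mask (map negb m) s)) =
  int_seq (count id m) F * int_seq (count negb m) G.
Proof.
elim: m F G => [|b m IH] F G mF F0 mG G0; first by rewrite !int_seq0.
have mM : seq_measurable (fun s => F (mask (b :: m) s) * G (mask (map negb (b :: m)) s)).
  by move=> n; apply: emeasurable_funM; exact: (seq_measurable_mask _ _).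
have M0 s : 0 <= F (mask (b :: m) s) * G (mask (map negb (b :: m)) s) by rewrite mule_ge0.
rewrite [size _]/= int_seqS//; case: b mM M0 => mM M0 /=.
- rewrite add1n add0n [X in X * _]int_seqS//.
  transitivity (\int[mu]_x (int_seq (count id m) (fun s => F (x :: s)) * int_seq (count negb m) G)).
    by apply: eq_integral => x _; rewrite -IH//; exact: seq_measurable_cons.
  rewrite ge0_integralZr//.
  + exact: measurable_int_seq.
  + by move=> x _; exact: int_seq_ge0.
  + exact: int_seq_ge0.
- rewrite add1n add0n [X in _ * X]int_seqS//.
  transitivity (\int[mu]_x (int_seq (count id m) F * int_seq (count negb m) (fun s => G (x :: s)))).
    by apply: eq_integral => x _; rewrite -IH//; exact: seq_measurable_cons.
  rewrite ge0_integralZl//.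
  + exact: measurable_int_seq.
  + by move=> x _; exact: int_seq_ge0.
  + exact: int_seq_ge0.
Qed.

End tuple_integral.

Section translation.
Local Open Scope ereal_scope.
Context (R : realType) (d : nat).
Local Notation T := (spacetime R d).

(** Lebesgue measure is determined by its values on half-open intervals, and a
    translation preserves their lengths. *)
Lemma integral_lebesgue_shift (c : R) (f : measurableTypeR R -> \bar R) :
  measurable_fun setT f -> (forall x, 0 <= f x) ->
  \int[@lebesgue_measure R]_x f (x + c)%R = \int[@lebesgue_measure R]_x f x.
Proof.
move=> mf f0.
have mc : measurable_fun setT (fun x : measurableTypeR R => (x + c)%R : measurableTypeR R).
  by apply: measurable_funD => //; exact: measurable_cst.
have mfc : measurable_fun setT (fun x : measurableTypeR R => f (x + c)%R).
  exact: (measurableT_comp mf mc).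
have mc' : measurable_fun setT (fun x : measurableTypeR R => (x - c)%R : measurableTypeR R).
  by apply: measurable_funB => //; exact: measurable_cst.
have cK : cancel (fun x : measurableTypeR R => (x + c)%R : measurableTypeR R)
  (fun x : measurableTypeR R => (x - c)%R : measurableTypeR R) by move=> x; rewrite addrK.
pose nu : {measure set (measurableTypeR R) -> \bar R} := transport (@lebesgue_measure R) mc mc' cK.
rewrite -[LHS](_ : \int[nu]_x f x = _); last first.
  by rewrite ge0_integral_pushforward// preimage_setT.
apply: eq_measure_integral => A mA _; apply/esym.
apply: (@lebesgue_measure_unique R nu) => //.
move=> _ [[a b] _ <-]; rewrite /nu /= /transport /pushforward.
rewrite [X in _ = _ X](_ : _ = [set` `](a - c)%R, (b - c)%R]]); last first.
  by apply/seteqP; split => x /=; rewrite !in_itv/= ltrBlDr lerBrDr.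
rewrite !lebesgue_measure_itv/= !lte_fin ltrD2r.
by case: ifP => // _; rewrite -!EFinD; congr EFin; ring.
Qed.

Lemma integral_rV_shift (c : 'rV[R]_d) (f : 'rV[R]_d -> \bar R) :
  measurable_fun setT f -> (forall x, 0 <= f x) ->
  \int[lebesgue_rV R d]_x f (x + c)%R = \int[lebesgue_rV R d]_x f x.
Proof.
move=> mf f0.
have mc : measurable_fun setT (fun x : 'rV[R]_d => (x + c)%R).
  apply: measurable_fun_rV => i.
  rewrite (_ : (fun x => _) = fun x : 'rV[R]_d => (x ord0 i + c ord0 i)%R); last first.
    by apply/funext => x; rewrite mxE.
  by apply: measurable_funD; [exact: measurable_coor|exact: measurable_cst].
have mfc : measurable_fun setT (fun x : 'rV[R]_d => f (x + c)%R) by exact: (measurableT_comp mf mc).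
rewrite !ge0_integral_pushforward//; try exact: measurable_rV_of_tuple.
rewrite !preimage_setT.
(* Only indices below [d] occur, and for these [insub] finds the coordinate of [c]. *)
pose tau (i : nat) (x : measurableTypeR R) : measurableTypeR R :=
  (x + (if insub i is Some j then c ord0 j else 0))%R.
rewrite -[RHS](@integral_tuple_map _ (measurableTypeR R) R (@lebesgue_measure R) d tau)//.
- apply: eq_integral => z _ /=; congr f; apply/rowP => i.
  by rewrite !mxE tnth_mktuple /tau valK.
- by move=> i; apply: measurable_funD => //; exact: measurable_cst.
- by move=> i g mg g0; exact: integral_lebesgue_shift.
- by apply: (measurableT_comp mf); exact: measurable_rV_of_tuple.
- by move=> z; exact: f0.
Qed.

Lemma measurable_spacetime_shift (c : T) : measurable_fun setT (fun y : T => (y + c)%R).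
Proof.
case: c => c1 c2.
rewrite (_ : (fun y => _) = fun y : T => ((y.1 + c1)%R, (y.2 + c2)%R)); last first.
  by apply/funext => -[].
apply: measurable_fun_pair.
  apply: measurable_fun_rV => i.
  rewrite (_ : (fun x => _) = fun x : T => (x.1 ord0 i + c1 ord0 i)%R); last first.
    by apply/funext => x; rewrite mxE.
  apply: measurable_funD; last exact: measurable_cst.
  by apply: (measurableT_comp (measurable_coor i)); exact: measurable_fst.
by apply: measurable_funD; [exact: measurable_snd|exact: measurable_cst].
Qed.

Lemma integral_ell_shift (c : T) (f : T -> \bar R) :
  measurable_fun setT f -> (forall x, 0 <= f x) ->
  \int[@ell R d]_x f (x + c)%R = \int[@ell R d]_x f x.
Proof.
move=> mf f0.
have mfc : measurable_fun setT (fun x : T => f (x + c)%R).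
  exact: (measurableT_comp mf (measurable_spacetime_shift c)).
rewrite -[LHS]/(\int[(lebesgue_rV R d \x @lebesgue_measure R)%E]_p f (p + c)%R).
rewrite -[RHS]/(\int[(lebesgue_rV R d \x @lebesgue_measure R)%E]_p f p).
rewrite !fubini_tonelli1// /fubini_F.
rewrite -[RHS](integral_rV_shift c.1); last 2 first.
- exact: (@measurable_fun_fubini_tonelli_F _ _ _ _ R (@lebesgue_measure R) f mf f0).
- by move=> x; exact: integral_ge0.
apply: eq_integral => x _.
by rewrite -[RHS](integral_lebesgue_shift c.2)//; exact: measurable_fun_pair2.
Qed.

Lemma seq_measurable_shift (c : T) d' (X : measurableType d') (h : seq T -> X) : seq_measurable h ->
  seq_measurable (fun s => h [seq (y + c)%R | y <- s]).
Proof.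
move=> mh n.
have mt := measurable_tuple_map (n := n) (fun=> measurable_spacetime_shift c).
apply: eq_measurable_fun (measurableT_comp (mh n) mt) => z _; symmetry; congr h.
by rewrite /tuple_map /= -[in LHS](map_tnth_enum z) -map_comp.
Qed.

Lemma int_seq_shift n (c : T) (h : seq T -> \bar R) : seq_measurable h -> (forall s, 0 <= h s) ->
  int_seq (@ell R d) n (fun s => h [seq (y + c)%R | y <- s]) = int_seq (@ell R d) n h.
Proof.
move=> mh h0; rewrite /int_seq.
rewrite -[RHS](@integral_tuple_map _ _ _ _ n (fun=> fun y : T => (y + c)%R))//.
- apply: eq_integral => z _; congr h.
  by rewrite /tuple_map /= -[in LHS](map_tnth_enum z) -map_comp.
- by move=> i; exact: measurable_spacetime_shift.
- by move=> i f mf f0; exact: integral_ell_shift.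
Qed.

End translation.

(** * Set partitions and cluster sums *)

Section masks.

Fixpoint masks n : seq bitseq :=
  if n is m.+1 then map (cons true) (masks m) ++ map (cons false) (masks m) else [:: [::]].

Lemma mem_masks n m : (m \in masks n) = (size m == n).
Proof.
elim: n m => [|n IH] [|b m] //=.
  by rewrite mem_cat; apply/negbTE/norP; split; apply/negP => /mapP[].
rewrite mem_cat eqSS -IH; apply/orP/idP => [[|] /mapP[m' h [_ ->]]//|h].
by case: b; [left|right]; apply: map_f.
Qed.

Lemma uniq_masks n : uniq (masks n).
Proof.
elim: n => //= n IH; rewrite cat_uniq !map_inj_uniq; try by move=> ? ? [].
rewrite IH andbT /=; apply/hasPn => _ /mapP[m _ ->]; by apply/negP => /mapP[].
Qed.

Lemma sum_masks (R : comNzRingType) n (H : nat -> R) :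
  \sum_(m <- masks n) H (count id m) = \sum_(k < n.+1) 'C(n, k)%:R * H k.
Proof.
elim: n H => [|n IH] H.
  by rewrite /= big_seq1 big_ord_recl big_ord0 bin0 mul1r addr0.
rewrite /= big_cat !big_map /=.
rewrite (IH (fun k => H (1 + k)%N)) (IH (fun k => H (0 + k)%N)).
rewrite [RHS]big_ord_recl bin0 mul1r.
under [in RHS]eq_bigr => i _ do rewrite lift0 binS natrD mulrDl addrC.
rewrite big_split/= [RHS]addrCA; congr (_ + _).
rewrite [LHS]big_ord_recl bin0 mul1r; congr (_ + _).
rewrite [RHS]big_ord_recr /= bin_small// mul0r addr0.
by apply: eq_bigr => i _.
Qed.

Lemma count_negb m : count negb m = (size m - count id m)%N.
Proof. by rewrite -(count_predC id m) addKn. Qed.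

End masks.

Section cluster_sum.
Context (T : eqType) (R : comNzRingType).
Implicit Types (f g : seq T -> R) (s : seq T).

Fixpoint cluster_rec f k s : R :=
  match k, s with
  | _, [::] => 1
  | 0%N, _ => 0
  | k.+1, x :: s' =>
    \sum_(m <- masks (size s')) f (x :: mask m s') * cluster_rec f k (mask (map negb m) s')
  end.

(** The sum, over the partitions of the positions in [s], of the product of [f] over
    the blocks. Peeling off the block of the first element gives a recursion on
    sequences; each mask of the tail is one choice of that block. *)
Definition cluster_sum f s := cluster_rec f (size s) s.

Lemma size_mask_negb m s : (size (mask (map negb m) s) <= size s)%N.
Proof. by apply: size_subseq; exact: mask_subseq. Qed.

Lemma cluster_rec_fuel f k s : (size s <= k)%N -> cluster_rec f k s = cluster_sum f s.
Proof.
have [n] := ubnP (size s); elim: n k s => // n IH [|k] [|x s] //= sn sk.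
rewrite /cluster_sum /=; apply: eq_bigr => m _; congr (_ * _).
rewrite IH.
- by rewrite [RHS]IH//; [exact: leq_ltn_trans (size_mask_negb m s) _|exact: size_mask_negb].
- exact: leq_ltn_trans (size_mask_negb m s) _.
- exact: leq_trans (size_mask_negb m s) _.
Qed.

Lemma cluster_sum_nil f : cluster_sum f [::] = 1.
Proof. by []. Qed.

Lemma cluster_sum_cons f x s : cluster_sum f (x :: s) =
  \sum_(m <- masks (size s)) f (x :: mask m s) * cluster_sum f (mask (map negb m) s).
Proof.
rewrite /cluster_sum /=; apply: eq_bigr => m _; congr (_ * _).
by rewrite cluster_rec_fuel//; exact: size_mask_negb.
Qed.

Lemma eq_cluster_sum f g s :
  (forall s', subseq s' s -> (0 < size s')%N -> f s' = g s') -> cluster_sum f s = cluster_sum g s.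
Proof.
have [n] := ubnP (size s); elim: n s => // n IH [|x s] //= sn fg.
rewrite !cluster_sum_cons; apply: eq_bigr => m _; congr (_ * _).
  by apply: fg => //=; rewrite eqxx mask_subseq.
apply: IH; first exact: leq_ltn_trans (size_mask_negb m s) _.
move=> s' ss' s'0; apply: fg s'0.
exact: subseq_trans ss' (subseq_trans (mask_subseq _ _) (subseq_cons _ _)).
Qed.

End cluster_sum.

Lemma cluster_sum_map (T T' : eqType) (R : comNzRingType) (h : T' -> T) (f : seq T -> R) s :
  cluster_sum (f \o map h) s = cluster_sum f (map h s).
Proof.
have [n] := ubnP (size s); elim: n s => // n IH [|x s] //= sn.
rewrite !cluster_sum_cons size_map; apply: eq_bigr => m _.
rewrite /= -!map_mask IH//; exact: leq_ltn_trans (size_mask_negb m s) _.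
Qed.

Section set_partitions.
Import mathcomp.boot.finset.
Local Open Scope set_scope.
Local Open Scope ring_scope.
Context (I : finType) (R : comNzRingType).

Definition partition_sum (F : {set I} -> R) (A : {set I}) : R :=
  \sum_(E : {set {set I}} | partition E A) \prod_(D in E) F D.

Lemma partition_sum0 F : partition_sum F set0 = 1.
Proof.
rewrite /partition_sum (big_pred1 set0); first by rewrite big_set0.
by move=> E; rewrite partition_set0.
Qed.

(** Classify the partitions by the block that contains [i]. *)
Lemma partition_sum_rec F (A : {set I}) i : i \in A ->
  partition_sum F A =
  \sum_(D : {set I} | (i \in D) && (D \subset A)) F D * partition_sum F (A :\: D).
Proof.
move=> iA; rewrite /partition_sum.
rewrite (partition_big (fun E => pblock E i) (fun D => (i \in D) && (D \subset A))) /=; last first.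
  move=> E pE; have cE : i \in cover E by rewrite (cover_partition pE).
  by rewrite mem_pblock cE (partitionS pE)// pblock_mem.
apply: eq_bigr => D /andP[iD DA]; rewrite big_distrr /=.
rewrite (reindex_onto (fun E => D |: E) (fun E => E :\ D)) /=; last first.
  move=> E /andP[pE /eqP <-]; rewrite setD1K// pblock_mem// (cover_partition pE)//.
have dis : fintype.disjoint (mem D) (mem (A :\: D)) by rewrite disjoints_subset setCD subsetUr.
have notin E : partition E (A :\: D) -> D \notin E.
  move=> pE; apply/negP => /(partitionS pE) /fintype.subsetP /(_ i iD).
  by rewrite inE iD.
apply: eq_big => E.
  apply/andP/idP => [[/andP[pE /eqP DE] /eqP EE]|pE].
    have DU : D \in D |: E by rewrite !inE eqxx.
    by rewrite -EE; exact: partitionD1.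
  have D0 : D != set0 by apply/set0Pn; exists i.
  have pU : partition (D |: E) A.
    rewrite [A in partition _ A](_ : A = D :|: (A :\: D)); first exact: partitionU1.
    apply/setP => y; rewrite !inE; case yD : (y \in D) => //=; exact: (fintype.subsetP DA).
  split; last by rewrite setU1K// notin.
  rewrite pU /=; apply/eqP/def_pblock => //; first exact: partition_trivIset pU.
  by rewrite !inE eqxx.
move=> /andP[/andP[pE _] /eqP EE].
rewrite -[in LHS]EE big_setU1//; last by rewrite !inE eqxx.
by rewrite EE.
Qed.

Lemma enum_subseq (s : seq I) : subseq s (enum I) -> enum [set x in s] = s.
Proof.
move=> ss; rewrite [RHS](elimT (subseq_uniqP (enum_uniq _)) ss).
rewrite {1}enumT /enum_mem; apply: eq_filter => x; by rewrite !inE.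
Qed.

(** A choice of the block of [x] in a set partition is thus a choice of mask. *)
Lemma sum_subsets_masks (g : {set I} -> R) x s : uniq (x :: s) ->
  \sum_(D : {set I} | (x \in D) && (D \subset [set y in x :: s])) g D =
  \sum_(m <- masks (size s)) g [set y in x :: mask m s].
Proof.
move=> us; have [xs us'] := andP us.
rewrite -(big_map (fun m => [set y in x :: mask m s]) xpredT g) -[LHS]big_filter.
apply: perm_big; apply: uniq_perm.
- by rewrite filter_uniq// index_enum_uniq.
- rewrite map_inj_in_uniq ?uniq_masks// => m m'.
  rewrite !mem_masks => /eqP ms /eqP ms' /setP e.
  apply: (@eq_from_nth _ false); first by rewrite ms.
  move=> i; rewrite ms => si; have := e (nth x s i).
  rewrite !inE !in_mask// index_uniq// mem_nth// (_ : (_ == x) = false)//.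
  by apply: contraNF xs => /eqP <-; rewrite mem_nth.
- move=> D; rewrite mem_filter mem_index_enum andbT.
  apply/andP/mapP => [[xD /fintype.subsetP Ds]|[m]].
    exists (map (mem D) s); first by rewrite mem_masks size_map.
    rewrite -filter_mask; apply/setP => y; rewrite !inE mem_filter.
    have [->//|yx] := eqVneq y x; apply/idP/andP => [yD|[]//].
    by split => //; have := Ds _ yD; rewrite !inE (negbTE yx).
  rewrite mem_masks => /eqP ms ->; rewrite !inE eqxx; split => //.
  apply/fintype.subsetP => y; rewrite !inE => /orP[->//|/mem_mask ->]; exact: orbT.
Qed.

Lemma partition_sum_cluster (f : seq I -> R) (s : seq I) : subseq s (enum I) ->
  partition_sum (fun D => f (enum D)) [set x in s] = cluster_sum f s.
Proof.
have [n] := ubnP (size s); elim: n s => // n IH [|x s] sn ss.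
  by rewrite (_ : [set _ in _] = set0) ?partition_sum0//; apply/setP => y; rewrite !inE.
have us : uniq (x :: s) by exact: subseq_uniq ss (enum_uniq I).
have [xs us'] := andP us.
rewrite (@partition_sum_rec _ _ x) ?inE ?eqxx//.
rewrite (@sum_subsets_masks (fun D => f (enum D) * partition_sum _ (_ :\: D)))//.
rewrite cluster_sum_cons big_seq [RHS]big_seq; apply: eq_bigr => m.
rewrite mem_masks => /eqP ms; congr (_ * _).
  rewrite enum_subseq//; apply: subseq_trans ss => /=; rewrite eqxx; exact: mask_subseq.
rewrite -IH; first last.
- apply: subseq_trans ss; apply: subseq_trans (mask_subseq _ _) _; exact: subseq_cons.
- exact: leq_ltn_trans (size_mask_negb m s) _.
congr partition_sum; apply/setP => y; rewrite !inE !in_mask//.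
have [->|yx] := eqVneq y x; first by rewrite (negbTE xs).
rewrite /=; case ys : (y \in s) => //=.
by rewrite andbT (nth_map false)// ms index_mem.
Qed.

End set_partitions.

(** * Translation-invariant versions of the reweighted densities *)

Section seq_functions.
Context (R : realType) (d : nat).
Local Notation T := (spacetime R d).
Implicit Types rho xi xit : forall n, n.-tuple T -> R.

Definition on_seq (f : forall n, n.-tuple T -> R) (s : seq T) : R := f (size s) (in_tuple s).

Lemma on_seqE f n (z : n.-tuple T) : on_seq f z = f n z.
Proof.
rewrite /on_seq; case: z => s sz /=; move: (eqP sz) => e.
case: n / e in sz *; congr f; exact: val_inj.
Qed.

Lemma reweighted_cluster_sum rho xi n (y : n.-tuple T) : correlation_functions rho xi ->
  (0 < n)%N -> reweighted rho y = cluster_sum (on_seq xi) y.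
Proof.
move=> [_ xiE] n0; rewrite xiE//.
rewrite (eq_bigr (fun E : {set {set 'I_n}} =>
  \prod_(D in E) (on_seq xi \o map (tnth y)) (enum D))); last first.
  move=> E _; apply: eq_bigr => D _; rewrite -on_seqE; congr on_seq.
  transitivity (map (fun i => tnth y (enum_val i)) (enum 'I_#|D|)).
    by rewrite -[enum _]val_ord_tuple.
  rewrite -[in RHS](map_tnth_enum (enum_tuple D)) -[RHS]map_comp.
  apply: eq_map => i /=.
  by rewrite (tnth_nth (enum_default i)).
rewrite -[RHS](congr1 _ (map_tnth_enum y)) -cluster_sum_map.
rewrite -partition_sum_cluster//; congr partition_sum.
by apply/setP => i; rewrite !inE mem_enum.
Qed.

Section versions.
Variables xi xit : forall n, n.-tuple T -> R.
Hypothesis txi : translation_invariant_versions xi xit.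

Lemma on_seq_shift c s : (0 < size s)%N -> on_seq xit [seq y + c | y <- s] = on_seq xit s.
Proof.
move=> s0; have [_ _ h] := txi s0.
rewrite -[RHS](h c) -on_seqE; congr on_seq.
transitivity (map (fun i => tnth (in_tuple s) i + c) (enum 'I_(size s))).
  by rewrite (map_comp (fun y => y + c) (tnth (in_tuple s))) map_tnth_enum.
by rewrite -[enum _]val_ord_tuple.
Qed.

Lemma cluster_sum_shift c s :
  cluster_sum (on_seq xit) [seq y + c | y <- s] = cluster_sum (on_seq xit) s.
Proof.
rewrite -cluster_sum_map; apply: eq_cluster_sum => s' _ s'0.
exact: on_seq_shift.
Qed.

Lemma seq_measurable_on_seq : seq_measurable (on_seq xit).
Proof.
move=> [|n]; first exact: measurable_fun_tuple0.
have [m _ _] := txi (ltn0Sn n).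
by apply: eq_measurable_fun m => z _; rewrite on_seqE.
Qed.

Lemma seq_measurable_cluster_sum : seq_measurable (cluster_sum (on_seq xit)).
Proof.
move=> n; have [N] := ubnP n; elim: N n => // N IH [|n] nN.
  exact: measurable_fun_tuple0.
have mb : measurable_fun setT (fun z : n.+1.-tuple T => (uncons_pair z).2).
  by apply: (measurableT_comp measurable_snd); exact: measurable_uncons_pair.
apply: (@eq_measurable_fun _ _ _ _ _ (fun z : n.+1.-tuple T => \sum_(m <- masks n)
  on_seq xit (mask (true :: m) z) * cluster_sum (on_seq xit) (mask (map negb m) (uncons_pair
    z).2))).
  move=> z _; case/tupleP: z => x z /=; rewrite cluster_sum_cons size_tuple.
  by apply: eq_bigr => m _; rewrite /= .
apply: measurable_sum => m; apply: measurable_funM;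
  first exact: (seq_measurable_mask _ seq_measurable_on_seq).
have [k [f [mf fE]]] := @measurable_mask _ T n (map negb m).
have kn : (k <= n)%N.
  rewrite -(size_tuple (f [tuple of nseq n point])) fE.
  by rewrite (leq_trans (size_subseq (mask_subseq _ _)))// size_nseq.
have mc := measurableT_comp (IH k (leq_ltn_trans kn nN)) (measurableT_comp mf mb).
by apply: eq_measurable_fun mc => z _ /=; rewrite fE.
Qed.

Definition ae_seq n (p : seq T -> Prop) :=
  {ae tuple_measure (@ell R d) n, forall z : n.-tuple T, p z}.

Definition seqset k (N : set (k.-tuple T)) : set (seq T) :=
  [set s | exists2 z : k.-tuple T, N z & tval z = s].

Lemma seqsetE k (N : set (k.-tuple T)) (z : k.-tuple T) : seqset N z <-> N z.
Proof. by split => [[z' + /val_inj <-]//|Nz]; exists z. Qed.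

Lemma measurable_seqset k (N : set (k.-tuple T)) n : measurable N ->
  measurable [set z : n.-tuple T | seqset N z].
Proof.
move=> mN; have [e|nk] := pselect (n = k).
  subst n; rewrite (_ : mkset _ = N)//.
  by apply/seteqP; split => z /=; move/seqsetE.
rewrite (_ : mkset _ = set0)//; apply/seteqP; split => // z [z' _ zz'].
by apply: nk; rewrite -(size_tuple z) -(size_tuple z') zz'.
Qed.

Lemma seq_measurable_seqset k (N : set (k.-tuple T)) : measurable N ->
  seq_measurable (fun s => (\1_(seqset N) s)%:E : \bar R).
Proof.
move=> mN n; apply/measurable_EFinP.
rewrite (_ : (fun z : n.-tuple T => _) = \1_[set z : n.-tuple T | seqset N z]).
  by apply: measurable_indic; exact: measurable_seqset.
by apply/funext => z.
Qed.

Lemma int_seq_seqset k (N : set (k.-tuple T)) n : measurable N ->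
  int_seq (@ell R d) n (fun s => (\1_(seqset N) s)%:E) =
  tuple_measure (@ell R d) n [set z : n.-tuple T | seqset N z].
Proof.
move=> mN; rewrite /int_seq -[X in tuple_measure _ _ X]setIT -integral_indic//.
exact: measurable_seqset.
Qed.

(** By [int_seq_mask], the sequences whose selected part falls in a null set have
    measure [0 * _ = 0], even if the other factor is infinite. *)
Lemma ae_seq_mask m p : ae_seq (count id m) p -> ae_seq (size m) (fun s => p (mask m s)).
Proof.
move=> [N [mN N0 Np]].
have mF := seq_measurable_seqset mN.
have mG : seq_measurable (fun _ : seq T => 1%E : \bar R) by move=> n; exact: measurable_cst.
have F0 s : (0 <= (\1_(seqset N) s)%:E :> \bar R)%E by rewrite lee_fin.
have := @int_seq_mask _ _ _ (@ell R d) m _ (fun=> 1%E) mF F0 mG (fun=> lee01).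
rewrite int_seq_seqset// (_ : [set z : (count id m).-tuple T | seqset N z] = N); last first.
  by apply/seteqP; split => z /=; move/seqsetE.
rewrite N0 mul0e => h.
have [k [f [mf fE]]] := @measurable_mask _ T (size m) m.
have mNm : measurable [set z : (size m).-tuple T | seqset N (mask m z)].
  rewrite -[X in measurable X]setTI.
  rewrite (_ : mkset _ = f @^-1` [set z : k.-tuple T | seqset N z]).
    by apply: mf => //; exact: measurable_seqset.
  by apply/seteqP; split => z /=; rewrite fE.
exists [set z : (size m).-tuple T | seqset N (mask m z)]; split => //.
  rewrite -[X in tuple_measure _ _ X]setIT -integral_indic// -[RHS]h.
  by apply: eq_integral => z _; rewrite mule1.
move=> z /= npz.
have sm : size (mask m z) == count id m by rewrite size_mask// size_tuple.
apply/(seqsetE N (Tuple sm)); apply: Np => /= h'.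
by apply: npz; have := h'.
Qed.

Lemma ae_seq_masks n p : (forall k, (k <= n)%N -> ae_seq k p) ->
  ae_seq n (fun s => forall s', subseq s' s -> p s').
Proof.
move=> h.
have : {ae tuple_measure (@ell R d) n, forall z : n.-tuple T, forall i : nat,
    p (mask (nth (nseq n false) (masks n) i) z)}.
  apply: ae_foralln => i.
  have /eqP sm : size (nth (nseq n false) (masks n) i) == n.
    have [ni|ni] := ltnP i (size (masks n)); first by rewrite -mem_masks mem_nth.
    by rewrite nth_default// size_nseq.
  have := @ae_seq_mask (nth (nseq n false) (masks n) i) p.
  rewrite sm; apply; apply: h.
  by rewrite -[leqRHS]sm count_size.
apply: filterS => z pz s' /subseqP[m ms ->].
have mm : m \in masks n by rewrite mem_masks ms size_tuple.
by have := pz (index m (masks n)); rewrite nth_index.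
Qed.

Lemma ae_cluster_sum n : ae_seq n (fun s => cluster_sum (on_seq xi) s = cluster_sum (on_seq xit) s).
Proof.
have : ae_seq n (fun s => forall s', subseq s' s -> (0 < size s')%N -> on_seq xi s' =
  on_seq xit s').
  apply: ae_seq_masks => -[|k] _.
    by apply: aeW => z; rewrite (tuple0 z).
  have [_ + _] := txi (ltn0Sn k); apply: filterS => z h _.
  by rewrite !on_seqE.
by apply: filterS => z h; exact: eq_cluster_sum.
Qed.

(** Changing every correlation function to its invariant version changes the partition
    sum only when some subsequence of the points falls in a null set. Hence
    [cluster_sum (on_seq xit)] is a version of the reweighted density that is exactly
    invariant under translations. *)
Lemma ae_reweighted rho n : correlation_functions rho xi -> (0 < n)%N ->
  {ae tuple_measure (@ell R d) n, forall z, reweighted rho z = cluster_sum (on_seq xit) z}.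
Proof.
move=> rx n0; have [N [mN N0 hN]] := ae_cluster_sum n.
exists N; split => // z /= hz; apply: hN => /= e; apply: hz; rewrite -e.
exact: reweighted_cluster_sum.
Qed.

End versions.

(** For an invariant property [p], Fubini makes [p (x :: s)] false for almost every
    [s], for almost every [x]; by invariance the null set for [x] is a translate of the
    one for [0]. *)
Lemma ae_seq_fix (p : set (seq T)) n : (0 < @ell R d setT)%E ->
  seq_measurable (fun s => (\1_p s)%:E : \bar R) ->
  (forall c s, p [seq y + c | y <- s] <-> p s) ->
  ae_seq n.+1 (fun s => ~ p s) -> ae_seq n (fun s => ~ p (0 :: s)).
Proof.
move=> ell0 mp pc [N [mN N0 Np]].
have p0 s : (0 <= (\1_p s)%:E :> \bar R)%E by rewrite lee_fin.
have indE s s' : (p s <-> p s') -> \1_p s = \1_p s' :> R.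
  by move=> e; rewrite !indicE; congr (_%:R); congr nat_of_bool; apply/idP/idP =>
    /set_mem/e/mem_set.
(* The measure of the bad tails does not depend on the first point. *)
pose K := int_seq (@ell R d) n (fun s => (\1_p (0 :: s))%:E).
have KE x : int_seq (@ell R d) n (fun s => (\1_p (x :: s))%:E) = K.
  rewrite -(int_seq_shift n x (seq_measurable_cons x mp))//.
  apply: eq_integral => z _; congr EFin; apply: indE.
  by rewrite -(pc x (0 :: z)) /= add0r.
have I0 : int_seq (@ell R d) n.+1 (fun s => (\1_p s)%:E) = 0%E.
  apply/eqP; rewrite eq_le int_seq_ge0// andbT -N0.
  rewrite -[X in tuple_measure _ _ X]setIT -integral_indic//.
  apply: ge0_le_integral => //.
  - exact: mp.
  - by apply/measurable_EFinP; exact: measurable_indic.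
  - move=> z _; rewrite lee_fin !indicE ler_nat.
    have [/set_mem pz|//] := boolP ((z : seq T) \in p).
    by rewrite (_ : z \in N)//; apply/mem_set/Np => /(_ pz).
have K0 : K = 0%E.
  move: I0; rewrite int_seqS//; under eq_integral do rewrite KE.
  rewrite integral_cst// => /eqP; rewrite mule_eq0 => /orP[/eqP //|/eqP e].
  by move: ell0; rewrite e ltxx.
have mpn : measurable [set z : n.-tuple T | p (0 :: z)].
  have mc : seq_measurable (fun s : seq T => (\1_p (0 :: s))%:E) := seq_measurable_cons (0 : T) mp.
  have /measurable_EFinP := mc n.
  by move/measurable_indicP.
exists [set z : n.-tuple T | p (0 :: z)]; split => //.
  by rewrite -[X in tuple_measure _ _ X]setIT -integral_indic// -[RHS]K0.
by move=> z /= /contrapT.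
Qed.

End seq_functions.

(** * Series of nonnegative reals *)

Section real_series.
Context (R : realType).
Implicit Types a b : nat -> R.

Lemma nneseries_ltyP b : (forall n, 0 <= b n) ->
  (\sum_(n <oo) (b n)%:E < +oo)%E <-> exists2 B, 0 <= B & forall M, \sum_(n < M) b n <= B.
Proof.
move=> b0; have b0' n : (0 <= (b n)%:E)%E by rewrite lee_fin.
split=> [|[B B0 hB]].
  have : (0 <= \sum_(n <oo) (b n)%:E)%E by apply: nneseries_ge0 => n _ _.
  case e : (\sum_(n <oo) (b n)%:E)%E => [B| |]//; rewrite lee_fin => B0 _; exists B => // M.
  rewrite -lee_fin -e -sumEFin -(big_mkord xpredT (fun i => (b i)%:E)).
  exact: nneseries_lim_ge.
apply: (@le_lt_trans _ _ B%:E); last by rewrite ltry.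
apply: lime_le; first by apply: is_cvg_nneseries => n _ _.
by apply: nearW => M; rewrite big_mkord sumEFin lee_fin.
Qed.

(** The pairs of indices summed on the left lie in the square summed on the right. *)
Lemma cauchy_product_le a b M : (forall n, 0 <= a n) -> (forall n, 0 <= b n) ->
  \sum_(n < M) \sum_(k < n.+1) a k * b (n - k)%N <=
  (\sum_(k < M) a k) * \sum_(j < M) b j.
Proof.
move=> a0 b0.
have -> : \sum_(n < M) \sum_(k < n.+1) a k * b (n - k)%N =
          \sum_(k < M) a k * \sum_(j < M - k) b j.
  elim: M => [|M IH]; first by rewrite !big_ord0.
  rewrite big_ord_recr/= IH [in RHS]big_ord_recr /= subSnn big_ord1.
  rewrite [X in _ + X]big_ord_recr/= subnn addrA; congr (_ + _).
  rewrite -big_split/=; apply: eq_bigr => k _.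
  by rewrite -mulrDr subSn ?(ltnW (ltn_ord k))// big_ord_recr.
rewrite mulr_suml; apply: ler_sum => k _; rewrite ler_wpM2l//.
rewrite -!(big_mkord xpredT b) [leRHS](@big_cat_nat _ _ _ (M - k)%N)//= ?leq_subr//.
by rewrite lerDl sumr_ge0.
Qed.

Lemma root_test b (u : nat -> \bar R) : (forall n, 0 <= b n) ->
  (forall n, (0 < n)%N -> u n = ((b n)%:E `^ n%:R^-1)%E) ->
  (limn_esup u < 1)%E -> (\sum_(n <oo) (b n)%:E < +oo)%E.
Proof.
move=> b0 uE.
rewrite limn_esup_lim (cvg_lim _ (@cvg_esups_inf _ u))// => /ereal_inf_lt[_ [n0 _ <-] q1].
have uq n : (n0 <= n)%N -> (u n <= esups u n0)%E.
  by move=> n0n; apply: ereal_sup_ubound; exists n.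
have q0 : (0 <= esups u n0)%E.
  by apply: le_trans (uq n0.+1 (leqnSn _)); rewrite uE// poweR_ge0.
case e : (esups u n0) q0 q1 uq => [q| |]//; rewrite lee_fin lte_fin => q0 q1 uq.
have bq n : (n0 < n)%N -> b n <= q ^+ n.
  move=> n0n; have n_gt0 : (0 < n)%N by exact: leq_ltn_trans n0n.
  have := uq _ (ltnW n0n); rewrite uE// poweR_EFin lee_fin => h.
  rewrite -[b n]powRr1// -(@mulVf _ n%:R) ?pnatr_eq0 -?lt0n// powRrM.
  by rewrite powR_mulrn ?powR_ge0// lerXn2r ?nnegrE ?powR_ge0.
apply/nneseries_ltyP => //.
(* Beyond [n0] the terms are dominated by a geometric series. *)
have q1' : 0 < 1 - q by rewrite subr_gt0.
exists (\sum_(n < n0.+1) b n + (1 - q)^-1).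
  by rewrite addr_ge0 ?sumr_ge0// invr_ge0 ltW.
move=> M.
have geo : \sum_(n < M) q ^+ n <= (1 - q)^-1.
  rewrite -[leRHS]mul1r ler_pdivlMr// mulrC -opprB mulNr -subrX1 opprB.
  by rewrite gerBl exprn_ge0.
apply: (@le_trans _ _ (\sum_(n < n0.+1 + M) b n)).
  rewrite -!(big_mkord xpredT b) [leRHS](@big_cat_nat _ _ _ M)//= ?leq_addl//.
  by rewrite lerDl sumr_ge0.
rewrite big_split_ord/= lerD2l; apply: le_trans geo; apply: ler_sum => i _.
apply: (le_trans (bq _ _)); first by rewrite ltn_addr.
by rewrite exprD ler_piMl ?exprn_ge0// exprn_ile1// ltW.
Qed.

End real_series.

(** * Moments over the cylinder *)

Section cylinder_moments.
Local Open Scope ereal_scope.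
Context (R : realType) (d : nat).
Local Notation T := (spacetime R d).
Local Notation I := (int_seq (@ell R d)).
Variables (r t : R).

Definition cyl_indic (s : seq T) : R := (\prod_(y <- s) \1_(cyl r t) y)%R.

Lemma cyl_indic_ge0 s : (0 <= cyl_indic s)%R.
Proof. by apply: prodr_ge0. Qed.

Lemma cyl_indic_mask m s : size m = size s ->
  cyl_indic s = (cyl_indic (mask m s) * cyl_indic (mask (map negb m) s))%R.
Proof.
elim: m s => [|b m IH] [|y s]//; first by rewrite /cyl_indic !big_nil mulr1.
move=> [] /IH; rewrite /cyl_indic big_cons => ->.
by case: b; rewrite /= big_cons; [rewrite mulrA|rewrite mulrCA].
Qed.

Lemma seq_measurable_cyl_indic : seq_measurable cyl_indic.
Proof.
move=> n; rewrite (_ : (fun z => _) = fun z : n.-tuple T =>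
  (\prod_(i < n) \1_(cyl r t) (tnth z i))%R); last first.
  by apply/funext => z; rewrite /cyl_indic big_tuple.
apply: measurable_prod => i _.
have mi : measurable_fun setT (\1_(cyl r t) : T -> R).
  by apply: measurable_indic; exact: measurable_cyl.
exact: (measurableT_comp mi (@measurable_tnth _ T n i)).
Qed.

Lemma seq_measurable_cyl_indicM (f : seq T -> R) : seq_measurable f -> seq_measurable (fun s =>
  (cyl_indic s * f s)%:E).
Proof.
move=> mf n; apply/measurable_EFinP; apply: measurable_funM; last exact: mf.
exact: seq_measurable_cyl_indic.
Qed.

Definition pospart (x : R) : R := Num.max x 0%R.

Lemma pospart_ge0 x : (0 <= pospart x)%R. Proof. by rewrite /pospart le_max lexx orbT. Qed.

Lemma pospart_id x : (0 <= x)%R -> pospart x = x. Proof. by move=> x0; rewrite /pospart max_l. Qed.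

Lemma pospartB x : (pospart x - pospart (- x))%R = x.
Proof.
rewrite /pospart; have [x0|x0] := leP 0%R x.
  by rewrite max_r ?oppr_le0// subr0.
by rewrite max_l ?oppr_ge0 ?ltW// opprK add0r.
Qed.

Lemma seq_measurable_pospart (f : seq T -> R) : seq_measurable f -> seq_measurable (fun s =>
  pospart (f s)).
Proof. by move=> mf n; apply: measurable_maxr; [exact: mf|exact: measurable_cst]. Qed.

Lemma seq_measurable_opp (f : seq T -> R) : seq_measurable f -> seq_measurable (fun s => (- f s)%R).
Proof. by move=> mf n; apply: measurableT_comp => //; exact: mf. Qed.

Lemma seq_measurable_cyl_pospart (f : seq T -> R) : seq_measurable f ->
  seq_measurable (fun s => (cyl_indic s * pospart (f s))%:E).
Proof. by move=> mf; apply: seq_measurable_cyl_indicM; apply: seq_measurable_pospart. Qed.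

(** The integral of [f] over the [n]-th power of the cylinder, when [f] is nonnegative
    almost everywhere; taking positive parts keeps it within the integrals of
    nonnegative functions. *)
Definition cyl_moment (f : seq T -> R) n : \bar R := I n (fun s =>
  (cyl_indic s * pospart (f s))%:E).

Lemma cyl_moment_ge0 f n : 0 <= cyl_moment f n.
Proof. by apply: int_seq_ge0 => s; rewrite lee_fin mulr_ge0 ?cyl_indic_ge0 ?pospart_ge0. Qed.

Section clusters.
Variable X : seq T -> R.
Let X0 s := X (0 :: s)%R.
Let W := cluster_sum X.
Let W0 s := W (0 :: s)%R.
Hypothesis mX : seq_measurable X.
Hypothesis mW : seq_measurable W.
Hypothesis W_ge0 : forall n, ae_seq n (fun s => 0 <= W s)%R.
Hypothesis W0_ge0 : forall n, ae_seq n (fun s => 0 <= W0 s)%R.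

Let mX0 : seq_measurable X0. Proof. exact: seq_measurable_cons. Qed.
Let mW0 : seq_measurable W0. Proof. exact: seq_measurable_cons. Qed.

Let nX0 s := (- X0 s)%R.

(** Split off the cluster of the origin in [W (0 :: s)] and integrate with
    [int_seq_mask]. As the correlation functions [X] may change sign, their negative
    parts are moved to the left, which leaves only integrals of nonnegative functions. *)
Lemma cyl_moment_cluster n :
  cyl_moment W0 n + \sum_(m <- masks n) cyl_moment nX0 (count id m) * cyl_moment W (count negb m) =
  \sum_(m <- masks n) cyl_moment X0 (count id m) * cyl_moment W (count negb m).
Proof.
pose F f m (s : seq T) := (cyl_indic (mask m s) * pospart (f (mask m s)))%:E.
have mF f m : seq_measurable f -> seq_measurable (F f m).
  by move=> mf; apply: (seq_measurable_mask m (h := fun s =>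
    (cyl_indic s * pospart (f s))%:E)); exact: seq_measurable_cyl_pospart.
have F0 f m s : 0 <= F f m s by rewrite lee_fin mulr_ge0 ?cyl_indic_ge0 ?pospart_ge0.
have sumE f : seq_measurable f -> \sum_(m <- masks n) cyl_moment f (count id m) * cyl_moment W
  (count negb m) =
    I n (fun s => \sum_(m <- masks n) F f m s * F W (map negb m) s).
  move=> mf; rewrite /int_seq ge0_integral_sum//; first last.
  - by move=> m z _; rewrite mule_ge0.
  - by move=> m; apply: emeasurable_funM; exact: mF.
  rewrite big_seq [RHS]big_seq; apply: eq_bigr => m; rewrite mem_masks => /eqP <-.
  rewrite /cyl_moment -int_seq_mask//.
  - exact: seq_measurable_cyl_pospart.
  - by move=> s; rewrite lee_fin mulr_ge0 ?cyl_indic_ge0 ?pospart_ge0.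
  - exact: seq_measurable_cyl_pospart.
  - by move=> s; rewrite lee_fin mulr_ge0 ?cyl_indic_ge0 ?pospart_ge0.
rewrite !sumE//; last exact: seq_measurable_opp.
have mS f : seq_measurable f -> measurable_fun setT (fun z : n.-tuple T =>
    \sum_(m <- masks n) F f m z * F W (map negb m) z).
  by move=> mf; apply: emeasurable_sum => m; apply: emeasurable_funM; exact: mF.
have S0 f s : 0 <= \sum_(m <- masks n) F f m s * F W (map negb m) s.
  by apply: sume_ge0 => m _; rewrite mule_ge0.
have mL : seq_measurable (fun s => (cyl_indic s * pospart (W0 s))%:E) by exact:
  seq_measurable_cyl_pospart.
have L0 s : 0 <= (cyl_indic s * pospart (W0 s))%:E by rewrite lee_fin mulr_ge0 ?cyl_indic_ge0
  ?pospart_ge0.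
rewrite {1}/cyl_moment /int_seq -ge0_integralD//; last 2 first.
- exact: mL.
- by apply: mS; exact: seq_measurable_opp.
apply: ge0_ae_eq_integral => //.
- by apply: emeasurable_funD; [exact: mL|apply: mS; exact: seq_measurable_opp].
- exact: mS.
- by move=> z _; rewrite adde_ge0.
have : ae_seq n (fun s => forall s', subseq s' s -> (0 <= W s')%R).
  by apply: ae_seq_masks => k _; exact: W_ge0.
move=> [N1 [mN1 N10 sub1]]; have [N2 [mN2 N20 sub2]] := W0_ge0 n.
exists (N1 `|` N2); split; first exact: measurableU.
  by rewrite null_set_setU.
move=> z /= nz.
have [h1|] := pselect (forall s', subseq s' z -> (0 <= W s')%R); last first.
  by move=> h; left; apply: sub1.
have [h2|] := pselect (0 <= W0 z)%R; last by move=> h; right; apply: sub2.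
exfalso; apply: nz => _; rewrite pospart_id// /W0 /W cluster_sum_cons size_tuple.
have FE f : \sum_(m <- masks n) F f m z * F W (map negb m) z =
   (\sum_(m <- masks n) cyl_indic z * (pospart (f (mask m z)) * W (mask (map negb m) z)))%:E.
  rewrite -sumEFin big_seq [RHS]big_seq; apply: eq_bigr => m; rewrite mem_masks => /eqP sm.
  rewrite /F -EFinM; congr EFin; rewrite [pospart (W _)]pospart_id; last by apply: h1;
    exact: mask_subseq.
  rewrite (@cyl_indic_mask m z) ?size_tuple//; ring.
rewrite !FE -EFinD; congr EFin; rewrite -mulr_sumr -!big_distrr /= -mulrDr -big_split/=.
congr (_ * _)%R; apply: eq_bigr => m _.
by rewrite -/(X0 (mask m z)) -/W -mulrDl -[X in (X + _)%R]pospartB subrK.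
Qed.

End clusters.
End cylinder_moments.

(** * Moments of the process *)

Section process.
Local Open Scope ereal_scope.
Context (R : realType) (d : nat).
Local Notation T := (spacetime R d).
Local Notation config := (config R d).
Context (dO : measure_display) (Omega : measurableType dO).
Variables (P : probability Omega R) (Y : Omega -> config).
Variables rho xi xit : forall n, n.-tuple T -> R.
Variables r t : R.
Hypothesis mY : measurable_fun setT Y.
Hypothesis Yirms : irms P Y rho xi.
Hypothesis txi : translation_invariant_versions xi xit.
Hypothesis ell0 : 0 < @ell R d setT.

Let lam := lambda rho.
Let lbar := lambda_bar rho.
Let X := on_seq xit.
Let W := cluster_sum X.
Let W0 s := W (0 :: s)%R.
Let u a := u_weight lam lbar r t a.

Lemma lambda_ge0 y : (0 <= lam y)%R.
Proof. by have [/(_ 1%N isT)[h _ _ _ _] _ _ _] := Yirms; exact: h. Qed.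

Lemma lambda_bar_gt0 : (0 < lbar)%R.
Proof. by have [] := Yirms. Qed.

Lemma lambda_bar_le y : (lbar <= lam y)%R.
Proof.
apply: ge_inf; last by exists y.
by exists 0%R => _ [z _ <-]; exact: lambda_ge0.
Qed.

Lemma lambda_gt0 y : (0 < lam y)%R.
Proof. exact: lt_le_trans lambda_bar_gt0 (lambda_bar_le y). Qed.

Lemma measurable_lambda : measurable_fun setT lam.
Proof.
have [/(_ 1%N isT)[_ h _ _ _] _ _ _] := Yirms.
apply: (measurableT_comp h); apply/measurable_fun_tnthP => i.
rewrite (_ : _ \o _ = id); first exact: measurable_id.
by apply/funext => y /=; rewrite ord1.
Qed.

Lemma measurable_lambdaV : measurable_fun setT (fun y => (lam y)^-1%R).
Proof.
(* The power [-1] is the inverse of a nonnegative number. *)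
apply: (@eq_measurable_fun _ _ _ _ _ (fun y => lam y `^ (-1))%R).
  by move=> y _; rewrite powR_inv1// lambda_ge0.
exact: (measurableT_comp (measurable_powR _) measurable_lambda).
Qed.

Lemma u_weightE a y : u a y = (lbar * \1_(cyl r t) (y - a)%R / lam y)%R.
Proof.
rewrite /u /u_weight indicE; congr (_ * _%:R / _)%R; congr nat_of_bool.
have eN (x : 'rV[R]_d) : enorm (- x) = enorm x.
  by rewrite /enorm; congr Num.sqrt; apply: eq_bigr => i _; rewrite mxE sqrrN.
rewrite -opprB eN distrC.
by apply/andP/idP => [h|/set_mem//]; apply/mem_set.
Qed.

Lemma u_weight_ge0 a y : (0 <= u a y)%R.
Proof. by rewrite u_weightE !mulr_ge0// ?invr_ge0 ?lambda_ge0// ltW// lambda_bar_gt0. Qed.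

(** The infimum [lambda_bar] of the intensity makes the weights at most one. *)
Lemma u_weight_le a y : (u a y <= \1_(cyl r t) (y - a)%R)%R.
Proof.
rewrite u_weightE mulrAC ler_piMl//.
by rewrite ler_pdivrMr ?lambda_gt0// mul1r lambda_bar_le.
Qed.

Lemma u_weight_le1 a y : (u a y <= 1)%R.
Proof. by apply: le_trans (u_weight_le a y) _; rewrite indicE; case: (_ \in _). Qed.

Lemma measurable_u_weight : measurable_fun setT (fun p : T * T => u p.1 p.2).
Proof.
apply: (@eq_measurable_fun _ _ _ _ _ (fun p : T * T =>
  lbar * \1_(cyl r t) (p.2 - p.1)%R / lam p.2)%R).
  by move=> p _; rewrite u_weightE.
apply: measurable_funM.
  apply: measurable_funM; first exact: measurable_cst.
  have mi : measurable_fun setT (\1_(cyl r t) : T -> R).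
    by apply: measurable_indic; exact: measurable_cyl.
  exact: (measurableT_comp mi (@measurable_spacetime_sub R d)).
exact: (measurableT_comp measurable_lambdaV (@measurable_snd _ _ _ _)).
Qed.

Lemma measurable_prod_u n :
  measurable_fun setT (fun p : T * n.-tuple T => (\prod_(y <- p.2) u p.1 y)%R).
Proof.
rewrite (_ : (fun p => _) = fun p : T * n.-tuple T => (\prod_(i < n) u p.1 (tnth p.2 i))%R);
  last first.
  by apply/funext => p; rewrite big_tuple.
apply: measurable_prod => i _.
have mp : measurable_fun setT (fun p : T * n.-tuple T => (p.1, tnth p.2 i)).
  apply: measurable_fun_pair; first exact: measurable_fst.
  by apply: (measurableT_comp (measurable_tnth i)); exact: measurable_snd.
exact: (measurableT_comp measurable_u_weight mp).
Qed.

Lemma measurable_factorial_sum n :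
  measurable_fun setT (fun p : T * config => factorial_sum (u p.1) n p.2).
Proof.
apply: (measurable_esum_distinct (h := fun p : T * n.-tuple T => (\prod_(y <- p.2) u p.1 y)%:E)).
  by move=> p; rewrite lee_fin; apply: prod_weight_ge0 => y; exact: u_weight_ge0.
by apply/measurable_EFinP; exact: measurable_prod_u.
Qed.

Lemma measurable_factorial_sum1 a n : measurable_fun setT (factorial_sum (u a) n).
Proof.
apply: eq_measurable_fun (measurable_fun_pair2 a (@measurable_factorial_sum n)) => phi _.
by [].
Qed.

Lemma prod_u_rho a n (z : n.-tuple T) : (0 < n)%N ->
  (\prod_(y <- z) u a y * rho z =
   lbar ^+ n * (cyl_indic r t [seq y - a | y <- z] * reweighted rho z))%R.
Proof.
move=> n0; rewrite /reweighted /cyl_indic big_map !big_tuple.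
under eq_bigr => i _ do rewrite u_weightE.
rewrite big_split big_split/= prodr_const card_ord prodfV; ring.
Qed.

Lemma measurable_reweighted n : (0 < n)%N -> measurable_fun setT (@reweighted R d rho n).
Proof.
move=> n0; have [/(_ n n0)[_ h _ _ _] _ _ _] := Yirms.
apply: (@eq_measurable_fun _ _ _ _ _ (fun z : n.-tuple T =>
  rho z * \prod_(i < n) (lam (tnth z i))^-1)%R).
  by move=> z _; rewrite prodfV.
apply: measurable_funM => //; apply: measurable_prod => i _.
exact: (measurableT_comp measurable_lambdaV (measurable_tnth i)).
Qed.

Lemma reweighted_ge0 n (z : n.-tuple T) : (0 < n)%N -> (0 <= reweighted rho z)%R.
Proof.
move=> n0; have [/(_ n n0)[h _ _ _ _] _ _ _] := Yirms.
by rewrite /reweighted divr_ge0// prodr_ge0// => i _; exact: lambda_ge0.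
Qed.

Let corr : correlation_functions rho xi. Proof. by have [] := Yirms. Qed.

Lemma ae_cluster_ge0 n : ae_seq n (fun s => 0 <= W s)%R.
Proof.
case: n => [|n].
  by apply: aeW => z; rewrite (tuple0 z) /W cluster_sum_nil.
have [N [mN N0 hN]] := ae_reweighted txi corr (ltn0Sn n).
exists N; split => // z /= hz; apply: hN => /= e; apply: hz.
by rewrite /W /X -e reweighted_ge0.
Qed.

Lemma seq_measurable_W : seq_measurable W. Proof. exact: seq_measurable_cluster_sum txi. Qed.
Lemma seq_measurable_X : seq_measurable X. Proof. exact: seq_measurable_on_seq txi. Qed.

Lemma ae_cluster0_ge0 n : ae_seq n (fun s => 0 <= W0 s)%R.
Proof.
have : ae_seq n (fun s => ~ [set s | W s < 0]%R (0 :: s)%R).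
  apply: ae_seq_fix => //.
  - move=> k; apply/measurable_EFinP.
    rewrite (_ : (fun z : k.-tuple T => _) = \1_[set z : k.-tuple T | (W z < 0)%R]); last first.
      by apply/funext => z.
    apply: measurable_indic; rewrite -[X in measurable X]setTI.
    rewrite (_ : mkset _ = (fun z : k.-tuple T => W z) @^-1` `]-oo, 0%R[).
      by apply: seq_measurable_W.
    by apply/seteqP; split => z /=; rewrite in_itv.
  - by move=> c s /=; rewrite /W (cluster_sum_shift txi).
  - move: (ae_cluster_ge0 n.+1) => [N [mN N0 hN]].
    exists N; split => // z /= hz; apply: hN => /= e; apply: hz.
    by rewrite ltNge e.
move=> [N [mN N0 hN]]; exists N; split => // z /= hz; apply: hN => /= e; apply: hz.
by rewrite /W0 leNgt; apply/negP.
Qed.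

(** The density of the factorial moment measure turns the expectation into the integral
    of the reweighted density over the translated cylinder; its invariant version and
    the invariance of [ell] remove the translation. The equality holds at every [a],
    as a finite grid requires. *)
Lemma expected_factorial_sum a n : \int[P]_w factorial_sum (u a) n (Y w) =
  (lbar ^+ n)%:E * cyl_moment r t W n.
Proof.
have u0 := u_weight_ge0 a.
case: n => [|n].
  rewrite /cyl_moment int_seq0 /cyl_indic big_nil /W cluster_sum_nil pospart_id// mulr1 mule1.
  rewrite expr0 (eq_integral (cst 1)); first by rewrite integral_cst// mul1e;
    exact: probability_setT.
  by move=> w _; rewrite /factorial_sum esum_distinct0 ?big_nil// => z;
    rewrite lee_fin prod_weight_ge0.
have [/(_ n.+1 isT)[rho0 mrho _ _ h] _ _ _] := Yirms.
have mpu := measurable_fun_pair2 a (@measurable_prod_u n.+1).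
rewrite /factorial_sum h; [|exact/measurable_EFinP|by move=> z; rewrite lee_fin prod_weight_ge0].
rewrite /cyl_moment -(int_seq_shift n.+1 (- a)%R (seq_measurable_cyl_pospart r t
  seq_measurable_W)); last first.
  by move=> s; rewrite lee_fin mulr_ge0 ?cyl_indic_ge0 ?pospart_ge0.
have mS : seq_measurable (fun s => (cyl_indic r t [seq y - a | y <- s]%R * pospart (W [seq y -
  a | y <- s])%R)%:E).
  exact: (seq_measurable_shift (- a)%R (seq_measurable_cyl_pospart r t seq_measurable_W)).
have S0 s : 0 <= (cyl_indic r t [seq y - a | y <- s]%R * pospart (W [seq y - a | y <- s])%R)%:E.
  by rewrite lee_fin mulr_ge0 ?cyl_indic_ge0 ?pospart_ge0.
rewrite /int_seq -ge0_integralZl//; [|exact: mS|]; last first. 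
  by rewrite lee_fin exprn_ge0// ltW// lambda_bar_gt0.
apply: ge0_ae_eq_integral => //.
- by apply: emeasurable_funM; exact/measurable_EFinP.
- by apply: emeasurable_funM; [exact: measurable_cst|exact: mS].
- by move=> z _; rewrite -EFinM lee_fin mulr_ge0// prod_weight_ge0.
- by move=> z _; rewrite mule_ge0// lee_fin exprn_ge0// ltW// lambda_bar_gt0.
have [N1 [mN1 N10 sub1]] := ae_reweighted txi corr (ltn0Sn n).
exists N1; split => // z /= nz; apply: sub1 => /= e; apply: nz => _.
rewrite -!EFinM prod_u_rho//; congr (_ * (_ * _))%:E%R.
by rewrite /W (cluster_sum_shift txi) -/X -e pospart_id// reweighted_ge0.
Qed.

Let B0 : st_bounded (cyl r t : set T).
Proof.
exists (Num.max r t) => z [h1 h2].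
by split; [apply: le_trans h1 _|apply: le_trans h2 _]; rewrite le_max lexx ?orbT.
Qed.

(** The weights are at most the indicator of the cylinder, and the factorial moment
    measures are locally finite. *)
Lemma cyl_moment_W_fin n : cyl_moment r t W n \is a fin_num.
Proof.
rewrite ge0_fin_numE ?cyl_moment_ge0//.
case: n => [|n].
  by rewrite /cyl_moment int_seq0 ltry.
have [/(_ n.+1 isT)[_ _ _ fin _] _ _ _] := Yirms.
have {}fin := fin _ (measurable_cyl r t) B0.
have lp : (0 < lbar ^+ n.+1)%R by rewrite exprn_gt0// lambda_bar_gt0.
have u0 := u_weight_ge0 0%R.
have : (lbar ^+ n.+1)%:E * cyl_moment r t W n.+1 < +oo.
  rewrite -(expected_factorial_sum 0%R); apply: le_lt_trans fin.
  apply: ge0_le_integral => //.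
  - by move=> w _; exact: factorial_sum_ge0.
  - exact: (measurableT_comp (@measurable_factorial_sum1 0%R n.+1) mY).
  - have mi : measurable_fun setT (fun p : unit * n.+1.-tuple T =>
        (\1_[set z : n.+1.-tuple T | forall i, cyl r t (tnth z i)] p.2)%:E : \bar R).
      apply/measurable_EFinP.
      have mc : measurable_fun setT (\1_[set z : n.+1.-tuple T | forall i,
        cyl r t (tnth z i)] : _ -> R).
        apply: measurable_indic.
        rewrite (_ : mkset _ = \bigcap_(i in [set: 'I_n.+1]) ((fun z : n.+1.-tuple T =>
          tnth z i) @^-1` cyl r t)); last first.
          by apply/seteqP; split => z /= h i; [move=> _|]; exact: h.
        apply: fin_bigcap_measurable => // i _; rewrite -[X in measurable X]setTI.
        apply: measurable_tnth => //; exact: measurable_cyl.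
      exact: (measurableT_comp mc (@measurable_snd _ _ _ _)).
    have mt : measurable_fun setT (fun w : Omega => (tt, Y w)).
      by apply: measurable_fun_pair; [exact: measurable_cst|exact: mY].
    apply: (measurableT_comp (measurable_esum_distinct _ mi) mt).
    by move=> z; rewrite lee_fin.
  - move=> w _; apply: le_esum => z _; rewrite lee_fin.
    rewrite indicE; have [_|/negP nz] := boolP (_ \in _).
      by rewrite big_tuple prodr_ile1// => i _; rewrite u_weight_le1 u0.
    have [i ni] : exists i, ~ cyl r t (tnth z i).
      by apply: contrapT => /forallNP h; apply: nz; apply/mem_set => i /=; apply: contrapT;
        exact: h.
    rewrite big_tuple (bigD1 i)//= u_weightE subr0 indicE memNset//.
    by rewrite mulr0 !mul0r.
move: (cyl_moment_ge0 r t W n.+1); case: (cyl_moment r t W n.+1) => [x| |] //= _;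
  first by move=> _; rewrite ltry.
by rewrite mulry gtr0_sg// mul1e.
Qed.

(** The integral of the reweighted [n]-th product density over the [n]-th power of
    the cylinder. *)
Definition fac_moment n : R := fine (cyl_moment r t W n).

Lemma fac_momentE n : cyl_moment r t W n = (fac_moment n)%:E.
Proof. by rewrite fineK// cyl_moment_W_fin. Qed.

Lemma fac_moment_ge0 n : (0 <= fac_moment n)%R.
Proof. by rewrite -lee_fin -fac_momentE cyl_moment_ge0. Qed.

Let moment_term n := (lbar ^+ n * fac_moment n / n`!%:R)%R.

Let moment_term_ge0 n : (0 <= moment_term n)%R.
Proof. by rewrite divr_ge0// mulr_ge0 ?fac_moment_ge0// exprn_ge0// ltW// lambda_bar_gt0. Qed.

Lemma cylpow_cyl_indic n (z : n.-tuple T) : (z \in cylpow n r t)%:R = cyl_indic r t z :> R.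
Proof.
rewrite /cyl_indic big_tuple; have [/set_mem zc|/negP nz] := boolP (z \in _).
  by rewrite big1// => i _; rewrite indicE mem_set//; exact: zc.
have [i ni] : exists i, ~ cyl r t (tnth z i).
  by apply: contrapT => /forallNP h; apply: nz; apply/mem_set => i /=; apply: contrapT; exact: h.
by rewrite (bigD1 i)//= indicE memNset// mul0r.
Qed.

Lemma patch_cylpow n (f : n.-tuple T -> R) :
  (EFin \o f) \_ (cylpow n r t) = (fun z => (cyl_indic r t z * f z)%:E).
Proof.
apply/funext => z; rewrite /patch -cylpow_cyl_indic.
by case: ifP => _; rewrite ?mul1r ?mul0r.
Qed.

Lemma moment_growthE n : (0 < n)%N ->
  moment_growth rho r t n = ((moment_term n)%:E `^ n%:R^-1).
Proof.
move=> n0; rewrite /moment_growth; congr (_ `^ _).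
rewrite -/lbar /moment_term mulrAC [in RHS]EFinM -fac_momentE; congr (_ * _).
rewrite integral_mkcond patch_cylpow.
apply: ge0_ae_eq_integral => //.
- apply/measurable_EFinP; apply: measurable_funM; last exact: measurable_reweighted.
  exact: seq_measurable_cyl_indic.
- exact: (seq_measurable_cyl_pospart r t seq_measurable_W).
- by move=> z _; rewrite lee_fin mulr_ge0 ?cyl_indic_ge0 ?reweighted_ge0.
- by move=> z _; rewrite lee_fin mulr_ge0 ?cyl_indic_ge0 ?pospart_ge0.
have [N1 [mN1 N10 sub1]] := ae_reweighted txi corr n0.
exists N1; split => // z /= nz; apply: sub1 => /= e; apply: nz => _.
by rewrite /W /X -e pospart_id// reweighted_ge0.
Qed.

Hypothesis growth : limn_esup (moment_growth rho r t) < 1.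

Lemma moment_series_lty : \sum_(n <oo) (moment_term n)%:E < +oo.
Proof. exact: (root_test moment_term_ge0 moment_growthE growth). Qed.

Let X0 s := X (0 :: s)%R.
Let nX0 s := (- X0 s)%R.
Let mX0 : seq_measurable X0. Proof. exact: seq_measurable_cons seq_measurable_X. Qed.

(** [J_n] is the integral of a function that may change sign. *)
Lemma J_nE n : J_n xit r t n = cyl_moment r t X0 n - cyl_moment r t nX0 n.
Proof.
rewrite /J_n integral_mkcond patch_cylpow integralE; congr (_ - _).
  apply: eq_integral => z _; rewrite funeposE -EFin_max /pospart maxr_pMr ?cyl_indic_ge0// mulr0.
  by rewrite /X0 /X -on_seqE.
apply: eq_integral => z _; rewrite funenegE -EFin_max /pospart maxr_pMr ?cyl_indic_ge0// mulr0.
by rewrite /nX0 /X0 /X -on_seqE mulrN.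
Qed.

Hypothesis Jdef : J_inhom_defined rho xit r t.

(** By convention the difference of two infinite parts is infinite, hence absolute convergence of
    the series that defines the J-function makes both parts finite. *)
Lemma cyl_moment_X0_fin n : cyl_moment r t X0 n \is a fin_num /\ cyl_moment r t nX0 n \is a fin_num.
Proof.
case: n => [|n]; first by rewrite /cyl_moment !int_seq0.
have : `| ((- lbar) ^+ n.+1 / n.+1`!%:R)%:E * J_n xit r t n.+1 | < +oo.
  apply: le_lt_trans Jdef.
  pose f k := `| ((- lbar) ^+ k / k`!%:R)%:E * J_n xit r t k |.
  rewrite -/(f n.+1); apply: (@le_trans _ _ (\sum_(1 <= k < n.+2) f k)).
    by rewrite big_nat_recr//= leeDr// sume_ge0// => k _; rewrite /f.
  by apply: nneseries_lim_ge => k _ _; rewrite /f.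
have c0 : ((- lbar) ^+ n.+1 / n.+1`!%:R != 0)%R.
  by rewrite mulf_neq0 ?invr_eq0 ?pnatr_eq0 -?lt0n ?fact_gt0// expf_neq0// oppr_eq0 gt_eqF//
    lambda_bar_gt0.
rewrite J_nE; move: (cyl_moment_ge0 r t X0 n.+1) (cyl_moment_ge0 r t nX0 n.+1).
case: (cyl_moment r t X0 n.+1) => [x| |]//; case: (cyl_moment r t nX0 n.+1) => [y| |]//= _ _.
all: by rewrite abseM /= mulry gtr0_sg ?normr_gt0// mul1e.
Qed.

Let J k := fine (J_n xit r t k).

Let J_fin k : J_n xit r t k = (J k)%:E.
Proof. by rewrite fineK// J_nE; have [h1 h2] := cyl_moment_X0_fin k; rewrite fin_numB h1. Qed.

Lemma cyl_moment_W0_sum n :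
  cyl_moment r t W0 n = (\sum_(m <- masks n) J (count id m) * fac_moment (count negb m))%:E.
Proof.
have := cyl_moment_cluster r t seq_measurable_X seq_measurable_W ae_cluster_ge0 ae_cluster0_ge0 n.
pose x k := fine (cyl_moment r t X0 k); pose y k := fine (cyl_moment r t nX0 k).
have xE k : cyl_moment r t X0 k = (x k)%:E by rewrite fineK//; have [] := cyl_moment_X0_fin k.
have yE k : cyl_moment r t nX0 k = (y k)%:E by rewrite fineK//; have [] := cyl_moment_X0_fin k.
have JE k : J k = (x k - y k)%R by apply: EFin_inj; rewrite -J_fin J_nE xE yE EFinB.
under eq_bigr => m _ do rewrite -/X -/nX0 -/W yE fac_momentE -EFinM.
under [in RHS]eq_bigr => m _ do rewrite -/X -/X0 -/W xE fac_momentE -EFinM.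
rewrite !sumEFin => e.
have := congr1 (fun z => z - (\sum_(m <- masks n) y (count id m) * fac_moment (count negb m))%:E) e.
rewrite -EFinB addeK// => ->; congr EFin.
rewrite -sumrB; apply: eq_bigr => m _; by rewrite JE mulrBl.
Qed.

(** The integral of the reweighted [(n+1)]-st product density over the [n]-th power of
    the cylinder, one point being fixed at the origin: up to the factor
    [lambda_bar ^ n], the moment of order [n] under the Palm distributions. *)
Definition palm_fac_moment n := fine (cyl_moment r t W0 n).

Lemma palm_fac_momentE n : cyl_moment r t W0 n = (palm_fac_moment n)%:E.
Proof. by rewrite /palm_fac_moment cyl_moment_W0_sum. Qed.

Lemma palm_fac_moment_ge0 n : (0 <= palm_fac_moment n)%R.
Proof. by rewrite -lee_fin -palm_fac_momentE cyl_moment_ge0. Qed.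

Let J_term n := (lbar ^+ n * `|J n| / n`!%:R)%R.

Let J_term_ge0 n : (0 <= J_term n)%R.
Proof. by rewrite divr_ge0// mulr_ge0// exprn_ge0// ltW// lambda_bar_gt0. Qed.

Lemma J_series_lty : \sum_(n <oo) (J_term n)%:E < +oo.
Proof.
(* The series of the J-function starts at index 1; the term 0 is finite. *)
rewrite (nneseries_split 0 1); last by move=> k _; rewrite lee_fin.
rewrite add0n big_nat1 lte_add_pinfty ?ltry//.
apply: le_lt_trans Jdef; rewrite le_eqVlt; apply/orP; left; apply/eqP.
apply: eq_eseriesr => k _; rewrite J_fin -EFinM /=; congr EFin.
rewrite /J_term !normrM normrX normrN (gtr0_norm lambda_bar_gt0) ger0_norm ?invr_ge0//.
by rewrite mulrAC.
Qed.

(** Counting the masks by their weight, [palm_fac_moment n] is the binomial convolution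
    of the [J_n] and the [fac_moment n]. After division by [n!] this is a Cauchy product. *)
Lemma palm_fac_moment_le n : (lbar ^+ n * palm_fac_moment n / n`!%:R <= \sum_(k < n.+1) J_term
  k * moment_term (n - k))%R.
Proof.
have -> : palm_fac_moment n = (\sum_(k < n.+1) 'C(n, k)%:R * (J k * fac_moment (n - k)))%R.
  rewrite -(sum_masks n (fun k => J k * fac_moment (n - k)))%R /palm_fac_moment
    cyl_moment_W0_sum /=.
  rewrite big_seq [RHS]big_seq; apply: eq_bigr => m; rewrite mem_masks => /eqP sm.
  by rewrite count_negb sm.
rewrite mulr_sumr mulr_suml; apply: ler_sum => k _.
have kn : (k <= n)%N by rewrite -ltnS.
have f0 j : (j`!%:R != 0 :> R)%R by rewrite pnatr_eq0 -lt0n fact_gt0.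
have -> : (lbar ^+ n * ('C(n, k)%:R * (J k * fac_moment (n - k))) / n`!%:R =
  (lbar ^+ k * J k / k`!%:R) * moment_term (n - k))%R.
  rewrite /moment_term -(bin_fact kn) !natrM -{1}(subnKC kn) exprD.
  have b0 : ('C(n, k)%:R != 0 :> R)%R by rewrite pnatr_eq0 -lt0n bin_gt0.
  by field; rewrite b0 !f0.
rewrite ler_wpM2r// /J_term ler_wpM2r ?invr_ge0// ler_wpM2l ?ler_norm//.
by rewrite exprn_ge0// ltW// lambda_bar_gt0.
Qed.

(** The J-series and the moment series converge absolutely, and so does their Cauchy
    product: this is where the J-function enters. *)
Lemma palm_series_lty : \sum_(n <oo) (lbar ^+ n * palm_fac_moment n / n`!%:R)%:E < +oo.
Proof.
have k0 n : (0 <= lbar ^+ n * palm_fac_moment n / n`!%:R)%R.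
  by rewrite divr_ge0// mulr_ge0 ?palm_fac_moment_ge0// exprn_ge0// ltW// lambda_bar_gt0.
have /(nneseries_ltyP J_term_ge0)[A A0 hA] := J_series_lty.
have /(nneseries_ltyP moment_term_ge0)[B B_0 hB] := moment_series_lty.
apply/(nneseries_ltyP k0); exists (A * B)%R; first exact: mulr_ge0.
move=> M; apply: (le_trans (ler_sum _ (fun (i : 'I_M) _ => palm_fac_moment_le i))).
apply: (le_trans (cauchy_product_le _ J_term_ge0 moment_term_ge0)).
by apply: ler_pM => //; apply: sumr_ge0.
Qed.

Lemma weight_product_expansion a (phi : config) :
  exists2 x : nat -> R, (forall n, factorial_sum (u a) n phi = (x n)%:E) &
   exists k, forall N, (k <= N)%N ->
    generating_product (u a) phi = (\sum_(n < N) (-1) ^+ n / n`!%:R * x n)%R.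
Proof.
apply: (generating_product_expansion _ _ (st_bounded_shift r t a)).
  exact: u_weight_ge0.
by move=> y ny; rewrite u_weightE indicE memNset// mulr0 mul0r.
Qed.

Lemma weight_product_ge0 a phi : (0 <= generating_product (u a) phi)%R.
Proof.
rewrite /generating_product; apply: prodr_ge0 => y _.
by rewrite subr_ge0 u_weight_le1.
Qed.

Lemma measurable_weight_product :
  measurable_fun setT (fun p : T * config => generating_product (u p.1) p.2).
Proof.
apply/measurable_EFinP.
pose f N (p : T * config) : \bar R :=
  (\sum_(n < N) (-1) ^+ n / n`!%:R * fine (factorial_sum (u p.1) n p.2))%:E.
apply: (emeasurable_fun_cvg f).
  move=> N; apply/measurable_EFinP; apply: measurable_sum => n.
  apply: measurable_funM; first exact: measurable_cst.
  by apply: (measurableT_comp _ (measurable_factorial_sum n)) => //; exact: measurable_fine.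
move=> p _; have [x xE [k kE]] := weight_product_expansion p.1 p.2.
apply: cvg_near_cst; exists k => // N /= kN; rewrite /f (kE N)//.
by congr EFin; apply: eq_bigr => n _; rewrite xE.
Qed.

Let mW0 : seq_measurable W0. Proof. exact: seq_measurable_cons seq_measurable_W. Qed.

(** The expected product of the [1 - u a y], that is, one minus the F-function. *)
Definition void_const : R := fine (limn (fun N =>
  (\sum_(n < N) (-1) ^+ n / n`!%:R * (lbar ^+ n * fac_moment n))%:E)).

Lemma integral_weight_product a :
  \int[P]_w (generating_product (u a) (Y w))%:E = void_const%:E /\
  P.-integrable setT (fun w => (generating_product (u a) (Y w))%:E).
Proof.
have [_ [e ip]] : measurable_fun setT (fun w => generating_product (u a) (Y w)) /\
  \int[P]_w (generating_product (u a) (Y w))%:E = limn (fun N =>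
    (\sum_(n < N) (-1) ^+ n / n`!%:R * (lbar ^+ n * fac_moment n))%:E) /\
  P.-integrable setT (EFin \o (fun w => generating_product (u a) (Y w))).
  apply: (@integral_alternating _ _ _ P _ (fun n w => factorial_sum (u a) n (Y w)) (fun n =>
    lbar ^+ n * fac_moment n)%R).
  - by move=> n; exact: (measurableT_comp (@measurable_factorial_sum1 a n) mY).
  - by move=> n w; apply: factorial_sum_ge0; exact: u_weight_ge0.
  - by move=> w; exact: weight_product_expansion.
  - by move=> n; rewrite expected_factorial_sum fac_momentE.
  - exact: moment_series_lty.
split => //; rewrite e /void_const fineK// -e.
exact: integrable_fin_num.
Qed.

(** * Moments of the Palm distributions *)

Variable Q : R.-pker T ~> config.
Hypothesis palm : reduced_palm P Y lam Q.

Lemma measurable_lamE : measurable_fun setT (fun a => (lam a)%:E).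
Proof. by apply/measurable_EFinP; exact: measurable_lambda. Qed.

Lemma measurable_indicE (B : set T) : measurable B -> measurable_fun setT (fun a =>
  (\1_B a)%:E : \bar R).
Proof. by move=> mB; apply/measurable_EFinP; exact: measurable_indic. Qed.

Lemma palm_indic (B : set T) (g : T * config -> \bar R) : measurable B ->
  measurable_fun setT g -> (forall z, 0 <= g z) ->
  \int[P]_w (\esum_(y in points (Y w)) ((\1_B y)%:E * g (y, remove (Y w) y))) =
  \int[@ell R d]_y ((\1_B y)%:E * (\int[Q y]_phi g (y, phi)) * (lam y)%:E).
Proof.
move=> mB mg g0.
rewrite (palm (g := fun p => (\1_B p.1)%:E * g p)).
- apply: eq_integral => a _ /=; congr (_ * _).
  by rewrite ge0_integralZl//; exact: measurable_fun_pair2.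
- apply: emeasurable_funM => //.
  exact: (measurableT_comp (measurable_indicE mB) (@measurable_fst _ _ _ _)).
- by move=> p; rewrite mule_ge0.
Qed.

Lemma intensity_measure (B : set T) : measurable B ->
  \int[P]_w (\esum_(y in points (Y w)) (\1_B y)%:E) = \int[@ell R d]_y ((\1_B y)%:E * (lam y)%:E).
Proof.
move=> mB; have := palm_indic mB (measurable_cst 1) (fun=> lee01).
under eq_integral do under eq_esum do rewrite mule1.
move=> ->; apply: eq_integral => a _; congr (_ * _).
rewrite (_ : \int[Q a]_phi _ = 1) ?mule1//.
by rewrite integral_cst// mul1e prob_kernel.
Qed.

Lemma intensity_fin (B : set T) : measurable B -> st_bounded B ->
  \int[@ell R d]_y ((\1_B y)%:E * (lam y)%:E) < +oo.
Proof.
move=> mB bB; rewrite -intensity_measure//.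
have [/(_ 1%N isT)[_ _ _ fin _] _ _ _] := Yirms.
rewrite (le_lt_trans _ (fin _ mB bB))// le_eqVlt; apply/orP; left; apply/eqP.
apply: eq_integral => w _; rewrite esum_distinctS; last by move=> z; rewrite lee_fin.
apply: eq_esum => y _; rewrite esum_distinct0; last by move=> z; rewrite lee_fin.
congr EFin; rewrite !indicE; congr (_%:R); congr nat_of_bool.
apply/idP/idP => /set_mem h; apply/mem_set.
  by move=> i; rewrite ord1.
exact: (h ord0).
Qed.

Lemma prod_u_lambda a (s : seq T) :
  (\prod_(y <- s) u a y * \prod_(y <- s) lam y =
    lbar ^+ size s * cyl_indic r t [seq y - a | y <- s])%R.
Proof.
elim: s => [|y s IH]; first by rewrite /cyl_indic !big_nil.
rewrite !big_cons mulrACA IH u_weightE divfK; last by rewrite gt_eqF// lambda_gt0.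
by rewrite /cyl_indic /= big_cons exprS; ring.
Qed.

Definition palm_factorial_sum n a := \int[Q a]_phi factorial_sum (u a) n phi.

Lemma measurable_palm_factorial_sum n : measurable_fun setT (palm_factorial_sum n).
Proof.
apply: (measurable_fun_integral_sfinite_kernel (fun p : T * config =>
  factorial_sum (u p.1) n p.2) Q).
  by move=> p; apply: factorial_sum_ge0; exact: u_weight_ge0.
exact: measurable_factorial_sum.
Qed.

(** The reduced Palm formula adds the point [a] to the tuples of distinct points, so
    that the left side is a moment of order [n+1] of the process. Its density at
    [a :: z], divided by the intensities of [z], is [lam a] times the reweighted density,
    and translating [a] to the origin leaves [palm_fac_moment n]. *)
Lemma palm_factorial_sum_integral n (B : set T) : measurable B ->
  \int[@ell R d]_a ((\1_B a)%:E * palm_factorial_sum n a * (lam a)%:E) =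
  \int[@ell R d]_a ((\1_B a)%:E * ((lbar ^+ n * palm_fac_moment n)%:E * (lam a)%:E)).
Proof.
move=> mB.
have up a z : (0 <= \prod_(y <- z) u a y)%R by apply: prod_weight_ge0; exact: u_weight_ge0.
have us p : 0 <= factorial_sum (u p.1) n p.2 by apply: factorial_sum_ge0; exact: u_weight_ge0.
rewrite -(palm_indic mB (measurable_factorial_sum n) us).
pose h (z : n.+1.-tuple T) : R := (\1_B (uncons_pair z).1 * \prod_(y <- (uncons_pair z).2) u
  (uncons_pair z).1 y)%R.
have h0 z : (0 <= h z)%R by rewrite mulr_ge0.
have mh : measurable_fun setT h.
  have mb : measurable_fun setT (\1_B : T -> R) by exact: measurable_indic.
  have mp : measurable_fun setT (fun p : T * n.-tuple T => (\1_B p.1 * \prod_(y <- p.2) u p.1 y)%R).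
    apply: measurable_funM; last exact: measurable_prod_u.
    exact: (measurableT_comp mb (@measurable_fst _ _ _ _)).
  exact: (measurableT_comp mp (@measurable_uncons_pair _ T n)).
transitivity (\int[P]_w (\esum_(z in distinct_tuples (Y w) n.+1) (h z)%:E)).
  apply: eq_integral => w _; rewrite esum_distinctS; last by move=> z; rewrite lee_fin.
  apply: eq_esum => y _; rewrite /factorial_sum -esumZl//.
  by move=> z; rewrite lee_fin.
have [/(_ n.+1 isT)[rho0 mrho _ _ rhoE] _ _ _] := Yirms.
rewrite rhoE; [|exact/measurable_EFinP|by move=> z; rewrite lee_fin h0].
pose C (z : n.+1.-tuple T) : seq T := [seq y - (uncons_pair z).1 | y <- (uncons_pair z).2]%R.
pose H (z : n.+1.-tuple T) : \bar R :=
  ((\1_B (uncons_pair z).1 * (lbar ^+ n * lam (uncons_pair z).1)) *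
   (cyl_indic r t (C z) * pospart (W z)))%:E.
have H0 z : 0 <= H z.
  rewrite lee_fin !mulr_ge0 ?cyl_indic_ge0 ?pospart_ge0 ?lambda_ge0//.
  by rewrite exprn_ge0// ltW// lambda_bar_gt0.
have mH : measurable_fun setT H.
  apply/measurable_EFinP; apply: measurable_funM; last first.
    apply: measurable_funM; last exact: (seq_measurable_pospart seq_measurable_W).
    rewrite (_ : (fun z => _) = fun z : n.+1.-tuple T =>
        (\prod_(i < n) \1_(cyl r t) (tnth (uncons_pair z).2 i - (uncons_pair z).1))%R); last first.
      by apply/funext => z; rewrite /cyl_indic big_map big_tuple.
    apply: measurable_prod => i _.
    have mi : measurable_fun setT (\1_(cyl r t) : T -> R).
      by apply: measurable_indic; exact: measurable_cyl.
    have mp : measurable_fun setT (fun p : T * n.-tuple T => (p.1, tnth p.2 i)).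
      apply: measurable_fun_pair; first exact: measurable_fst.
      by apply: (measurableT_comp (measurable_tnth i)); exact: measurable_snd.
    have mq := measurableT_comp (measurableT_comp (@measurable_spacetime_sub R d) mp)
      (@measurable_uncons_pair _ T n).
    exact: (measurableT_comp mi mq).
  have mf : measurable_fun setT (fun z : n.+1.-tuple T => (uncons_pair z).1).
    exact: (measurableT_comp (@measurable_fst _ _ _ _) (@measurable_uncons_pair _ T n)).
  have mb : measurable_fun setT (\1_B : T -> R) by exact: measurable_indic.
  apply: measurable_funM; first exact: (measurableT_comp mb mf).
  apply: measurable_funM; first exact: measurable_cst.
  exact: (measurableT_comp measurable_lambda mf).
transitivity (\int[tuple_measure (@ell R d) n.+1]_z H z).
  apply: ge0_ae_eq_integral => //.
  - by apply: emeasurable_funM; exact/measurable_EFinP.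
  - by move=> z _; rewrite mule_ge0// lee_fin.
  have [N1 [mN1 N10 sub1]] := ae_reweighted txi corr (ltn0Sn n).
  exists N1; split => // z /= nz; apply: sub1 => /= e; apply: nz => _.
  rewrite /H /C /W /X -e pospart_id ?reweighted_ge0// -EFinM; congr EFin.
  rewrite /h /reweighted; case/tupleP: z {e} => a z.
  rewrite (_ : uncons_pair _ = (a, z)); last exact: (cons_pairK (a, z)).
  have -> : (\prod_(i < n.+1) lambda rho (tnth [tuple of a :: z] i) =
    lam a * \prod_(y <- z) lam y)%R.
    by rewrite -(big_cons _ _ a z xpredT lam) big_tuple.
  rewrite /=.
  have e := prod_u_lambda a z; rewrite size_tuple in e.
  have l0 : (\prod_(y <- z) lam y != 0)%R.
    by rewrite prodf_seq_neq0; apply/allP => y _; rewrite /= gt_eqF// lambda_gt0.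
  have la0 : (lam a != 0)%R by rewrite gt_eqF// lambda_gt0.
  rewrite [RHS](_ : _ = \1_B a * (lbar ^+ n * cyl_indic r t [seq y - a | y <- z]) * rho [tuple
    of a :: z] / \prod_(y <- z) lam y)%R.
    by rewrite -e; field.
  by field; rewrite l0 la0.
rewrite integral_tupleS//.
apply: eq_integral => a _.
have WE z : W (a :: z) = W0 [seq y - a | y <- z]%R.
  by rewrite /W0 /W -(cluster_sum_shift txi (- a)%R (a :: z)) /= subrr.
transitivity (\int[tuple_measure (@ell R d) n]_z ((\1_B a * (lbar ^+ n * lam a))%:E *
    (cyl_indic r t [seq y - a | y <- z] * pospart (W0 [seq y - a | y <- z]))%R%:E)).
  by apply: eq_integral => z _; rewrite /H /C cons_pairK /= WE EFinM.
have mS := seq_measurable_shift (- a)%R (seq_measurable_cyl_pospart r t mW0).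
rewrite ge0_integralZl//; first last.
- by rewrite lee_fin !mulr_ge0 ?lambda_ge0// exprn_ge0// ltW// lambda_bar_gt0.
- by move=> z _; rewrite lee_fin mulr_ge0 ?cyl_indic_ge0 ?pospart_ge0.
- exact: mS.
rewrite -/(int_seq (@ell R d) n (fun s => (cyl_indic r t [seq y - a | y <- s] * pospart (W0
  [seq y - a | y <- s]))%R%:E)).
rewrite (int_seq_shift n (- a)%R (seq_measurable_cyl_pospart r t mW0)); last first.
  by move=> s; rewrite lee_fin mulr_ge0 ?cyl_indic_ge0 ?pospart_ge0.
rewrite -/(cyl_moment r t W0 n) palm_fac_momentE -!EFinM; congr EFin; ring.
Qed.

(** Both sides have the same integral over every bounded Borel set when multiplied
    by the locally integrable, positive intensity. *)
Lemma palm_factorial_sum_ae n :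
  {ae @ell R d, forall a, palm_factorial_sum n a = (lbar ^+ n * palm_fac_moment n)%:E}.
Proof.
pose f a := (lbar ^+ n * palm_fac_moment n)%:E * (lam a)%:E.
pose g a := palm_factorial_sum n a * (lam a)%:E.
have c0 : (0 <= lbar ^+ n * palm_fac_moment n)%R.
  by rewrite mulr_ge0 ?palm_fac_moment_ge0// exprn_ge0// ltW// lambda_bar_gt0.
have mf : measurable_fun setT f by apply: measurable_funeM; exact: measurable_lamE.
have mg : measurable_fun setT g.
  by apply: emeasurable_funM; [exact: measurable_palm_factorial_sum|exact: measurable_lamE].
have fg k : ae_eq (@ell R d) (nat_cyl k) f g.
  apply: integral_ae_eq.
  - exact: measurable_nat_cyl.
  - apply: integrableZl; first exact: measurable_nat_cyl.
    apply/integrableP; split; first exact: measurable_funTS measurable_lamE.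
    rewrite (eq_integral (fun a => (lam a)%:E)); last first.
      by move=> a _; rewrite gee0_abs// lee_fin lambda_ge0.
    rewrite integral_restrict_indic; apply: intensity_fin; first exact: measurable_nat_cyl.
    exact: st_bounded_nat_cyl.
  - exact: measurable_funTS mg.
  - move=> E _ mE; rewrite (integral_restrict_indic E f) (integral_restrict_indic E g)
    -palm_factorial_sum_integral//.
    by apply: eq_integral => a _; rewrite muleA.
have [N [mN N0 hN]] := ae_foralln fg.
exists N; split => // a /= na; apply: hN => /= h; apply: na.
have : setT a by [].
rewrite -(@bigcup_nat_cyl R d) => -[k _ ak].
have := h k ak; rewrite /f /g; have l0 := lambda_gt0 a.
case: (palm_factorial_sum n a) => [x| |].
- by rewrite -!EFinM => -[] /mulIf -> //; rewrite gt_eqF.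
- by rewrite mulyr gtr0_sg// mul1e.
- by rewrite mulNyr gtr0_sg// mul1e.
Qed.

(** The expected product of the [1 - u a y] under the Palm distributions, that is, one
    minus the G-function. *)
Definition palm_void_const : R := fine (limn (fun N =>
  (\sum_(n < N) (-1) ^+ n / n`!%:R * (lbar ^+ n * palm_fac_moment n))%:E)).

Lemma palm_weight_product_ae :
  {ae @ell R d, forall a, \int[Q a]_phi (generating_product (u a) phi)%:E = palm_void_const%:E}.
Proof.
have [N [mN N0 hN]] := ae_foralln palm_factorial_sum_ae.
exists N; split => // a /= na; apply: hN => /= h; apply: na.
have [_ [e ip]] : measurable_fun setT (generating_product (u a)) /\
  \int[Q a]_phi (generating_product (u a) phi)%:E = limn (fun N =>
    (\sum_(n < N) (-1) ^+ n / n`!%:R * (lbar ^+ n * palm_fac_moment n))%:E) /\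
  (Q a).-integrable setT (EFin \o (generating_product (u a))).
  apply: (@integral_alternating _ _ _ (Q a) _ (fun n => factorial_sum (u a) n) (fun n =>
    lbar ^+ n * palm_fac_moment n)%R).
  - by move=> n; exact: measurable_factorial_sum1.
  - by move=> n w; apply: factorial_sum_ge0; exact: u_weight_ge0.
  - by move=> w; exact: weight_product_expansion.
  - by move=> n; exact: h.
  - exact: palm_series_lty.
rewrite e /palm_void_const fineK// -e.
exact: integrable_fin_num.
Qed.

Lemma palm_void_const_ge0 : (0 <= palm_void_const)%R.
Proof.
have [N [mN N0 hN]] := palm_weight_product_ae.
have [a na] : exists a, ~ N a.
  apply: contrapT => /forallNP h; move: ell0; rewrite (_ : setT = N) ?N0 ?ltxx//.
  by apply/seteqP; split => // a _; apply: contrapT; exact: h.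
have e : \int[Q a]_phi (generating_product (u a) phi)%:E = palm_void_const%:E.
  by apply: contrapT => h; apply: na; exact: hN.
by rewrite -lee_fin -e; apply: integral_ge0 => phi _; rewrite lee_fin weight_product_ge0.
Qed.

Lemma F_inhomE : F_inhom lam lbar P Y r t = (1 - void_const)%R.
Proof.
apply: (ae_value_eq ell0); apply: aeW => a /=.
by rewrite unlock (integral_weight_product a).1 EFinB.
Qed.

Lemma G_inhomE : G_inhom lam lbar Q r t = (1 - palm_void_const)%R.
Proof.
apply: (ae_value_eq ell0); have [N [mN N0 hN]] := palm_weight_product_ae.
exists N; split => // a /= na; apply: hN => /= h; apply: na.
by rewrite h EFinB.
Qed.

(** * Expectations of the sums in the estimators *)

Lemma window_productE (l : T) (phi : config) :
  window_product lam lbar phi (cyl_at l r t) = generating_product (u l) phi.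
Proof.
rewrite /window_product /generating_product.
rewrite -(fsbig_widen (points phi `&` cyl_at l r t) (points phi)).
- apply: eq_fsbigr => y /set_mem[_ /cyl_atP cy].
  by rewrite u_weightE indicE mem_set// mulr1.
- by move=> y [].
- move=> y [py ny] /=; rewrite u_weightE indicE memNset ?mulr0 ?mul0r ?subr0//.
  by move=> cy; apply: ny; split => //; apply/cyl_atP.
Qed.

Lemma F_unbiased (Wd L : set T) : finite_set L -> L `&` Wd !=set0 ->
  unbiased P (fun w => F_estimator lam lbar Wd L r t (Y w)) (1 - F_inhom lam lbar P Y r t).
Proof.
move=> finL [l0 Ll0]; have finLW : finite_set (L `&` Wd) by exact: finite_setIl.
rewrite F_inhomE subKr /unbiased unlock /F_estimator /card_set.
set s := fset_set (L `&` Wd).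
have s0 : (0 < #|` s|)%N.
  by rewrite cardfs_gt0; apply/fset0Pn; exists l0; rewrite in_fset_set// mem_set.
rewrite (eq_integral (fun w => (#|` s|%:R^-1)%:E * \sum_(l <- s) (generating_product (u l) (Y
  w))%:E)); last first.
  move=> w _; rewrite sumEFin -EFinM fsbig_finite//; congr (_ * _)%:E%R.
  by apply: eq_bigr => l _; rewrite window_productE.
rewrite integralZl//; last first.
  by apply: integrable_sum => // l _; exact: (integral_weight_product l).2.
rewrite integral_sum//; last by move=> l; exact: (integral_weight_product l).2.
under eq_bigr => l _ do rewrite (integral_weight_product l).1.
rewrite sumEFin -EFinM big_const_seq count_predT iter_addr_0; congr EFin.
by rewrite -[X in (_ * X)%R]mulr_natl mulKf// pnatr_eq0 -lt0n.
Qed.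

Section window.
Variable Wd : set T.
Hypothesis mWd : measurable Wd.
Hypothesis bWd : st_bounded Wd.
Hypothesis Wd0 : 0 < @ell R d Wd.

Let m := \int[@ell R d]_y ((\1_Wd y)%:E * (lam y)%:E).

(** The intensity is bounded below by [lambda_bar > 0]. *)
Lemma window_intensity_gt0 : 0 < m.
Proof.
apply: (@lt_le_trans _ _ (lbar%:E * @ell R d Wd)).
  by rewrite mule_gt0// lte_fin lambda_bar_gt0.
rewrite /m -(setIT Wd) -integral_indic// -ge0_integralZl//; first last.
- by rewrite lee_fin ltW// lambda_bar_gt0.
- by apply: measurable_indicE.
apply: ge0_le_integral => //.
- by move=> y _; rewrite mule_ge0// lee_fin ltW// lambda_bar_gt0.
- by apply: measurable_funeM; exact: measurable_indicE.
- by apply: emeasurable_funM; [apply: measurable_indicE; rewrite setIT|exact: measurable_lamE].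
- move=> y _; rewrite setIT -!EFinM lee_fin mulrC ler_wpM2l//.
  exact: lambda_bar_le.
Qed.

Lemma expected_denominator : 'E_P[fun w => G_denominator Wd (Y w)] = m.
Proof.
rewrite unlock /m -intensity_measure//; apply: eq_integral => w _.
have fin := finite_points (Y w) bWd.
rewrite (_ : \esum_(y in points (Y w)) _ = \sum_(y <- fset_set (points (Y w) `&` Wd)) (\1_Wd
  y)%:E); last first.
  apply: esum_seq => //.
  - by move=> y; rewrite in_fset_set// => /set_mem[].
  - move=> y py; rewrite in_fset_set// indicE => /negP ny.
    by rewrite memNset// => Wy; apply: ny; apply/mem_set.
rewrite (eq_big_seq (fun=> 1%:E)); last first.
  by move=> y; rewrite in_fset_set// => /set_mem[_ Wy]; rewrite indicE mem_set.
by rewrite sumEFin big_const_seq count_predT iter_addr_0.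
Qed.

Lemma expected_numerator :
  'E_P[fun w => G_numerator lam lbar Wd r t (Y w)] = palm_void_const%:E * m.
Proof.
rewrite unlock.
have gp0 p : 0 <= (generating_product (u p.1) p.2)%:E :> \bar R by rewrite lee_fin;
  exact: weight_product_ge0.
have mgp : measurable_fun setT (fun p : T * config => (generating_product (u p.1) p.2)%:E).
  by apply/measurable_EFinP; exact: measurable_weight_product.
transitivity (\int[P]_w (\esum_(y in points (Y w)) ((\1_Wd y)%:E *
    (generating_product (u y) (remove (Y w) y))%:E))).
  apply: eq_integral => w _; have fin := finite_points (Y w) bWd.
  rewrite (_ : \esum_(y in points (Y w)) _ = \sum_(y <- fset_set (points (Y w) `&` Wd))
      ((\1_Wd y)%:E * (generating_product (u y) (remove (Y w) y))%:E)); last first.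
    apply: esum_seq => //.
    - by move=> y; rewrite mule_ge0// (gp0 (y, remove (Y w) y)).
    - by move=> y; rewrite in_fset_set// => /set_mem[].
    - move=> y py; rewrite in_fset_set// indicE => /negP ny.
      by rewrite memNset ?mul0e// => Wy; apply: ny; apply/mem_set.
  rewrite /G_numerator fsbig_finite//= -sumEFin; apply: eq_big_seq => y.
  rewrite in_fset_set// => /set_mem[_ Wy].
  by rewrite indicE mem_set// mul1e window_productE.
rewrite (palm_indic mWd mgp gp0) /= /m.
have Gm : measurable_fun setT (fun y => (\1_Wd y)%:E * (lam y)%:E).
  by apply: emeasurable_funM; [exact: measurable_indicE|exact: measurable_lamE].
have G0 := palm_void_const_ge0.
rewrite -ge0_integralZl//; last by move=> y _; rewrite mule_ge0// lee_fin lambda_ge0.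
apply: ge0_ae_eq_integral => //.
- apply: emeasurable_funM; last exact: measurable_lamE.
  apply: emeasurable_funM; first exact: measurable_indicE.
  exact: (measurable_fun_integral_sfinite_kernel (fun p : T * config =>
    (generating_product (u p.1) p.2)%:E) Q gp0 mgp).
- exact: measurable_funeM.
- move=> y _; rewrite !mule_ge0// ?lee_fin ?lambda_ge0//.
  by apply: integral_ge0 => phi _; exact: (gp0 (y, phi)).
- by move=> y _; rewrite !mule_ge0// lee_fin lambda_ge0.
have [N [mN N0 hN]] := palm_weight_product_ae.
exists N; split => // a /= na; apply: hN => /= h; apply: na => _.
by rewrite h muleCA muleA.
Qed.

Lemma G_ratio_unbiased :
  ratio_unbiased P (fun w => G_numerator lam lbar Wd r t (Y w))
    (fun w => G_denominator Wd (Y w)) (1 - G_inhom lam lbar Q r t).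
Proof.
rewrite /ratio_unbiased G_inhomE subKr expected_numerator expected_denominator.
have := window_intensity_gt0; have : m < +oo by exact: intensity_fin.
case: m => [x| |]// _; rewrite lte_fin => x0.
by rewrite -EFinM inver gt_eqF// -EFinM mulfK// gt_eqF.
Qed.

End window.
End process.

(** * Unbiasedness of the estimators *)

Theorem theorem3 (R : realType) (d : nat) (d_gt0 : (0 < d)%N)
    (dO : measure_display) (Omega : measurableType dO)
    (P : probability Omega R) (Y : Omega -> config R d)
    (rho xi xit : forall n, n.-tuple (spacetime R d) -> R)
    (Q : R.-pker (spacetime R d) ~> config R d)
    (WS : set 'rV[R]_d) (WT : set R) (L : set (spacetime R d)) (r t : R) :
  let lam := lambda rho in
  let lbar := lambda_bar rho in
  let W := erode_S WS r `*` erode_T WT t in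
  stpp P Y ->
  irms P Y rho xi ->
  translation_invariant_versions xi xit ->
  reduced_palm P Y lam Q ->
  compact (WS `*` WT) ->
  0 <= r -> 0 <= t ->
  J_inhom_defined rho xit r t ->
  (limn_esup (moment_growth rho r t) < 1)%E ->
  (0 < ell W)%E ->
  finite_set L -> L `<=` WS `*` WT -> L `&` W !=set0 ->
  unbiased P (fun w => F_estimator lam lbar W L r t (Y w))
    (1 - F_inhom lam lbar P Y r t) /\
  ratio_unbiased P (fun w => G_numerator lam lbar W r t (Y w))
    (fun w => G_denominator W (Y w))
    (1 - G_inhom lam lbar Q r t).
Proof.
move=> lam lbar W Ystpp Yirms txi palm cW r0 t0 Jdef growth W0 finL _ LW.
have [mW bW] : measurable W /\ st_bounded W.
  by apply: eroded_window => //; have [l [_ Wl]] := LW; exists l.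
have ell0 : (0 < @ell R d setT)%E.
  by apply: (lt_le_trans W0); apply: le_measure => //; [exact/mem_set|exact/mem_set].
have mY := Ystpp.1; split.
  by apply: (F_unbiased mY Yirms txi).
by apply: (G_ratio_unbiased mY Yirms txi).
Qed.
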